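(* Let $d,q,n\in\mathbb N^*$. Assume that all the functions $\vartheta_k:\mathbb R^d\to\mathbb M_{d,q}$, $k=0,\dots,n-1$, are Lipschitz continuous and that $X_0$ is a square integrable $\mathbb R^d$-valued random vector. Let $(Z_k)_{k=1,\dots,n}$ be an $\mathbb R^q$-valued white noise independent of $X_0$, and for every $k=1,\dots,n$ let $\breve Z_k=\varphi_k(Z_k)$ with $\varphi_k:\mathbb R^q\to\mathbb R^q$ Borel and bounded, $\mathbb E\,\breve Z_k=0$ and $\mathbb E[(Z_k^i-\breve Z_k^i)\breve Z_k^j]=0$ for all $i,j\in\{1,\dots,q\}$. Let $g_0:\mathbb R^d\to\mathbb R^d$ be a bounded Borel function, $\breve X_0=g_0(X_0)$ and, for $k=0,\dots,n-1$, $$X_{k+1}=X_k+\vartheta_k(X_k)Z_{k+1},\qquad \breve X_{k+1}=\breve X_k+\vartheta_k(\breve X_k)\breve Z_{k+1}.$$ Then, for every $k=0,\dots,n$, $$\|X_k-\breve X_k\|_2^2\le\|X_0-\breve X_0\|_2^2\prod_{i=1}^k\big(1+q[\vartheta_{i-1}]_{\rm Lip}^2\big)+\big(1+\|X_0\|_2^2\big)\prod_{i=1}^k\big(1+C(\vartheta_{i-1})\big)\sum_{\ell=1}^kc(\vartheta_{\ell-1})\,\|Z_\ell-\breve Z_\ell\|_2^2,$$ where $C(\vartheta)=\big(q[\vartheta]_{\rm Lip}^2\big)\vee c_{\rm Fr}(\vartheta)$. Moreover, $$\Big\|\max_{k=0,\dots,n}|X_k-\breve X_k|\Big\|_2^2\le4\,\|X_n-\breve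 X_n\|_2^2.$$
   Context: $\mathbb M_{d,q}$ is the space of real $d\times q$ matrices. $|\cdot|$ is the Euclidean norm, $|||B|||=\sup_{|x|\le1}|Bx|$ the operator norm and $\|B\|_{\rm Fr}=\sqrt{\mathrm{Tr}(BB^* )}$ the Frobenius norm of $B\in\mathbb M_{d,q}$. For a random vector $Y$, $\|Y\|_2=(\mathbb E|Y|^2)^{1/2}$. $[\vartheta]_{\rm Lip}$ is the Lipschitz constant of $\vartheta:(\mathbb R^d,|\cdot|)\to(\mathbb M_{d,q},|||\cdot|||)$, and $$c(\vartheta)=\sup_{x\in\mathbb R^d}\frac{|||\vartheta(x)|||^2}{1+|x|^2},\qquad c_{\rm Fr}(\vartheta)=\sup_{x\in\mathbb R^d}\frac{\|\vartheta(x)\|_{\rm Fr}^2}{1+|x|^2}.$$ Empty products equal $1$ and empty sums equal $0$. A white noise is a sequence of independent square integrable centered $\mathbb R^q$-valued random vectors with identity covariance matrix $I_q$. Superscripts $i,j$ denote coordinates. *)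

(* Defs.v *)
From HB Require Import structures.
From mathcomp Require Import all_boot all_order all_algebra.
From mathcomp Require Import all_classical all_reals all_analysis.

Set Implicit Arguments.
Unset Strict Implicit.
Unset Printing Implicit Defensive.

Import Order.TTheory GRing.Theory Num.Theory.
Import numFieldNormedType.Exports.

Local Open Scope classical_set_scope.
Local Open Scope ring_scope.

(* The library norm [`|x|] on matrices is the maximum norm, so the Euclidean,
   operator and Frobenius norms are defined here. *)
Definition euclid (R : realType) (m : nat) (x : 'cV[R]_m) : R :=
  Num.sqrt (\sum_(i < m) x i 0 ^+ 2).

Definition opnorm (R : realType) (m p : nat) (B : 'M[R]_(m, p)) : R :=
  sup [set euclid (B *m x) | x in [set x : 'cV[R]_p | euclid x <= 1]].

Definition frob (R : realType) (m p : nat) (B : 'M[R]_(m, p)) : R :=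
  Num.sqrt (\tr (B *m B^T)).

Definition lipschitz_op (R : realType) (m p : nat)
    (f : 'cV[R]_m -> 'M[R]_(m, p)) : Prop :=
  exists L : R, forall x y, opnorm (f x - f y) <= L * euclid (x - y).

(* [sup] is real-valued and equals 0 on sets that are empty or unbounded above;
   for Lipschitz [f] and [0 < m] the suprema below are genuine. *)
Definition lip (R : realType) (m p : nat) (f : 'cV[R]_m -> 'M[R]_(m, p)) : R :=
  sup [set opnorm (f xy.1 - f xy.2) / euclid (xy.1 - xy.2)
      | xy in [set xy : 'cV[R]_m * 'cV[R]_m | xy.1 != xy.2]].

Definition c_op (R : realType) (m p : nat)
    (f : 'cV[R]_m -> 'M[R]_(m, p)) : R :=
  sup (range (fun x => opnorm (f x) ^+ 2 / (1 + euclid x ^+ 2))).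

Definition c_frob (R : realType) (m p : nat)
    (f : 'cV[R]_m -> 'M[R]_(m, p)) : R :=
  sup (range (fun x => frob (f x) ^+ 2 / (1 + euclid x ^+ 2))).

Definition C_max (R : realType) (m p : nat)
    (f : 'cV[R]_m -> 'M[R]_(m, p)) : R :=
  Num.max (p%:R * lip f ^+ 2) (c_frob f).

(* R^m with its Borel sigma-algebra; the open sets are those of the maximum
   norm, hence also those of the Euclidean norm. *)
Definition borelV (R : realType) (m : nat) :=
  g_sigma_algebraType (@open 'cV[R]_m).

Definition borel_fun (R : realType) (m p : nat)
    (f : 'cV[R]_m -> 'cV[R]_p) : Prop :=
  measurable_fun [set: borelV R m] (f : borelV R m -> borelV R p).

Definition bounded_vfun (R : realType) (m p : nat)
    (f : 'cV[R]_m -> 'cV[R]_p) : Prop :=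
  exists M : R, forall x, euclid (f x) <= M.

Definition random_vector (disp : measure_display) (T : measurableType disp)
    (R : realType) (m : nat) (Y : T -> 'cV[R]_m) : Prop :=
  measurable_fun [set: T] (Y : T -> borelV R m).

Definition L2norm (disp : measure_display) (T : measurableType disp)
    (R : realType) (P : probability T R) (m : nat) (Y : T -> 'cV[R]_m)
    : \bar R :=
  'N[P]_2%:E[(fun w => (euclid (Y w))%:E)]%E.

Definition sigma_of (disp : measure_display) (T : measurableType disp)
    (R : realType) (m : nat) (Y : T -> 'cV[R]_m) : set (set T) :=
  g_sigma_algebra_preimage (Y : T -> borelV R m).

Definition sigma_of_family (disp : measure_display) (T : measurableType disp)
    (R : realType) (m n : nat) (Y : 'I_n -> T -> 'cV[R]_m) : set (set T) :=
  g_sigma_preimage (Y : 'I_n -> T -> borelV R m).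

Definition independent2 (disp : measure_display) (T : measurableType disp)
    (R : realType) (P : probability T R) (F G : set (set T)) : Prop :=
  forall A B, F A -> G B -> P (A `&` B) = (P A * P B)%E.

Definition mutually_independent (disp : measure_display)
    (T : measurableType disp) (R : realType) (P : probability T R)
    (I : finType) (F : I -> set (set T)) : Prop :=
  forall (J : {set I}) (E : I -> set T), (forall i, i \in J -> F i (E i)) ->
    P (\bigcap_(i in [set` J]) E i) = (\prod_(i in J) P (E i))%E.

Definition white_noise (disp : measure_display) (T : measurableType disp)
    (R : realType) (P : probability T R) (m n : nat)
    (Z : 'I_n -> T -> 'cV[R]_m) : Prop :=
  [/\ forall k, random_vector (Z k),
      mutually_independent P (fun k => sigma_of (Z k)),
      forall k, (L2norm P (Z k) < +oo)%E,
      forall k i, ('E_P[(fun w => Z k w i 0)%R] = 0)%E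
    & forall k i j, covariance P (fun w => Z k w i 0) (fun w => Z k w j 0)
                    = (i == j)%:R%:E].

(* Main.v *)
Require Import Defs.
From HB Require Import structures.
From mathcomp Require Import all_boot all_order all_algebra.
From mathcomp Require Import all_classical all_reals all_analysis.
From mathcomp Require Import measurable_realfun ring lra.

Set Implicit Arguments.
Unset Strict Implicit.
Unset Printing Implicit Defensive.

Import Order.TTheory GRing.Theory Num.Theory.
Import numFieldNormedType.Exports.

Local Open Scope classical_set_scope.
Local Open Scope ring_scope.

(** Write [D = X_k - Xb_k], [A = theta_k(X_k)], [B = theta_k(X_k) -
    theta_k(Xb_k)], [x = Z_{k+1} - Zb_{k+1}] and [y = Zb_{k+1}]. Subtracting the
    two recursions gives

      [X_{k+1} - Xb_{k+1} = D + A x + B y].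

    Here [D], [A], [B] are functions of the past [X_0, Z_1, ..., Z_k], whereas
    [x] and [y] are functions of [Z_{k+1}], which is independent of the past.
    Since [x] and [y] are centered and uncorrelated coordinate by coordinate,
    all cross terms vanish in mean square ([mean_sqr_martingale_step]), and
    independence splits the two remaining means ([mean_sqr_mulmx_le]):

      [E |A x|^2 <= c(theta_k) (1 + E |X_k|^2) E |x|^2],
      [E |B y|^2 <= Lip(theta_k)^2 E |D|^2 E |y|^2],

    with [E |y|^2 <= E |Z_{k+1}|^2 = q], as [Z_{k+1} = x + y] is an orthogonal
    decomposition. The same computation for [X] alone, where the covariance of
    [Z_{k+1}] is the identity, gives [E |X_{k+1}|^2 = E |X_k|^2 +
    E |theta_k(X_k)|_Fr^2] ([mean_sqr_mulmx_white]), hence a geometric bound on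
    [1 + E |X_k|^2]. The first inequality follows by [discrete_gronwall].

    For the maximal inequality, [D] is a martingale, so [S_k = |X_k - Xb_k|] is
    a submartingale ([mean_euclid_submartingale]). With [M_k] the running
    maximum of [S], the mean of [2 M_k S_k - M_k^2] is nondecreasing in [k]
    ([running_max_drift]); thus [E M_n^2 <= 2 E (M_n S_n)], and
    [2 M S <= M^2 / 2 + 2 S^2] yields [E M_n^2 <= 4 E S_n^2]. Every use of the
    martingale property is the factorization of the mean of a product of
    independent variables ([meanM_indep]).

    The independence of the past from the next noise ([past_indep]) is a
    pi-system argument from the mutual independence of the noises and their
    joint independence from [X_0]. *)

(** * Euclidean, operator and Frobenius norms *)

Section norms.
Variable R : realType.

Lemma euclid_ge0 m (x : 'cV[R]_m) : 0 <= euclid x.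
Proof. exact: sqrtr_ge0. Qed.

Lemma sqr_euclid m (x : 'cV[R]_m) : euclid x ^+ 2 = \sum_i x i 0 ^+ 2.
Proof. by rewrite sqr_sqrtr// sumr_ge0// => i _; exact: sqr_ge0. Qed.

Lemma sqr_coord_le m (x : 'cV[R]_m) i : x i 0 ^+ 2 <= euclid x ^+ 2.
Proof.
rewrite sqr_euclid (bigD1 i)//= lerDl sumr_ge0// => j _; exact: sqr_ge0.
Qed.

Lemma euclid_eq0 m (x : 'cV[R]_m) : (euclid x == 0) = (x == 0).
Proof.
apply/eqP/eqP => [x0|->]; last first.
  by apply/eqP; rewrite -sqrf_eq0 sqr_euclid big1// => i _; rewrite mxE expr0n.
apply/colP => i; rewrite mxE; apply/eqP; rewrite -sqrf_eq0 eq_le sqr_ge0 andbT.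
by rewrite (le_trans (sqr_coord_le x i))// x0 expr0n.
Qed.

Lemma sqr_frob m p (B : 'M[R]_(m, p)) :
  frob B ^+ 2 = \sum_i \sum_j B i j ^+ 2.
Proof.
have trE : \tr (B *m B^T) = \sum_i \sum_j B i j ^+ 2.
  apply: eq_bigr => i _; rewrite mxE; apply: eq_bigr => j _.
  by rewrite mxE expr2.
rewrite sqr_sqrtr trE// sumr_ge0// => i _.
by apply: sumr_ge0 => j _; exact: sqr_ge0.
Qed.

(** Expanding [0 <= \sum_i (c x_i - b y_i)^2] for [b = <x, y>], [c = |y|^2]
    gives [0 <= c (|x|^2 c - b^2)]. *)
Lemma sum_mul_sqr_le (I : finType) (x y : I -> R) :
  (\sum_i x i * y i) ^+ 2 <= (\sum_i x i ^+ 2) * (\sum_i y i ^+ 2).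
Proof.
set b := \sum_i _; set a := \sum_i x i ^+ 2; set c := \sum_i y i ^+ 2.
have : 0 <= c * (a * c - b ^+ 2).
  suff -> : c * (a * c - b ^+ 2) = \sum_i (c * x i - b * y i) ^+ 2.
    by apply: sumr_ge0 => i _; exact: sqr_ge0.
  have combE k l h : k * a - l * b + h * c =
      \sum_i (k * x i ^+ 2 - l * (x i * y i) + h * y i ^+ 2).
    by rewrite !mulr_sumr -sumrB -big_split.
  transitivity (c ^+ 2 * a - (c * b *+ 2) * b + b ^+ 2 * c); first by ring.
  by rewrite combE; apply: eq_bigr => i _; ring.
have [c0|c0] := ltrP 0 c; first by rewrite pmulr_rge0// subr_ge0.
have {}c0 : c = 0.
  by apply/eqP; rewrite eq_le c0 sumr_ge0// => i _; exact: sqr_ge0.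
move=> _; suff -> : b = 0 by rewrite c0 expr0n mulr0.
rewrite /b big1// => i _; apply/eqP; rewrite mulf_eq0 -[y i == 0]sqrf_eq0.
suff -> : y i ^+ 2 == 0 by rewrite orbT.
rewrite eq_le sqr_ge0 andbT -c0 /c (bigD1 i)//= lerDl.
by apply: sumr_ge0 => j _; exact: sqr_ge0.
Qed.

Lemma dot_le_euclid m (x y : 'cV[R]_m) :
  \sum_i x i 0 * y i 0 <= euclid x * euclid y.
Proof.
apply: le_trans (ler_norm _) _.
rewrite -(@ler_pXn2r _ 2%N) ?nnegrE ?mulr_ge0 ?euclid_ge0//.
by rewrite real_normK ?num_real// exprMn !sqr_euclid sum_mul_sqr_le.
Qed.

Lemma euclid_mulmx_le_frob m p (B : 'M[R]_(m, p)) (x : 'cV[R]_p) :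
  euclid (B *m x) ^+ 2 <= frob B ^+ 2 * euclid x ^+ 2.
Proof.
rewrite sqr_frob sqr_euclid mulr_suml; apply: ler_sum => i _.
by rewrite mxE sqr_euclid sum_mul_sqr_le.
Qed.

Lemma frob_ge0 m p (B : 'M[R]_(m, p)) : 0 <= frob B.
Proof. exact: sqrtr_ge0. Qed.

(** The supremum that defines [opnorm] is thus taken over a bounded set. *)
Lemma euclid_mulmx_ubound m p (B : 'M[R]_(m, p)) :
  ubound [set euclid (B *m x) | x in [set x : 'cV[R]_p | euclid x <= 1]]
    (frob B).
Proof.
move=> _ [x /= x1 <-].
rewrite -(@ler_pXn2r _ 2%N) ?nnegrE ?frob_ge0 ?euclid_ge0//.
apply: le_trans (euclid_mulmx_le_frob B x) _.
by rewrite ler_piMr ?sqr_ge0// exprn_ile1 ?euclid_ge0.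
Qed.

Lemma euclid_mulmx_le1 m p (B : 'M[R]_(m, p)) (x : 'cV[R]_p) :
  euclid x <= 1 -> euclid (B *m x) <= opnorm B.
Proof.
move=> x1; apply: ub_le_sup; last by exists x.
by exists (frob B); exact: euclid_mulmx_ubound.
Qed.

Lemma euclid0 m : euclid (0 : 'cV[R]_m) = 0.
Proof. by apply/eqP; rewrite euclid_eq0. Qed.

Lemma opnorm_ge0 m p (B : 'M[R]_(m, p)) : 0 <= opnorm B.
Proof.
by rewrite -(euclid0 m) -(mulmx0 _ B) euclid_mulmx_le1// euclid0.
Qed.

Lemma opnorm_le_frob m p (B : 'M[R]_(m, p)) : opnorm B <= frob B.
Proof.
apply: sup_le_ub; last exact: euclid_mulmx_ubound.
by exists (euclid (B *m 0)), 0 => //=; rewrite euclid0.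
Qed.

Lemma euclidZ m (a : R) (x : 'cV[R]_m) : euclid (a *: x) = `|a| * euclid x.
Proof.
apply/eqP; rewrite -(@eqrXn2 _ 2%N) ?mulr_ge0 ?euclid_ge0//.
rewrite exprMn real_normK ?num_real// !sqr_euclid mulr_sumr.
by apply/eqP/eq_bigr => i _; rewrite mxE exprMn.
Qed.

Lemma euclid_mulmx m p (B : 'M[R]_(m, p)) (x : 'cV[R]_p) :
  euclid (B *m x) <= opnorm B * euclid x.
Proof.
have [->|x0] := eqVneq x 0; first by rewrite mulmx0 !euclid0 mulr0.
have x_gt0 : 0 < euclid x by rewrite lt_neqAle euclid_ge0 eq_sym euclid_eq0 x0.
rewrite -ler_pdivrMr// mulrC -[(euclid x)^-1]gtr0_norm ?invr_gt0//.
rewrite -euclidZ scalemxAr euclid_mulmx_le1// euclidZ gtr0_norm ?invr_gt0//.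
by rewrite mulVf ?gt_eqF.
Qed.

Lemma sqr_euclid_mulmx m p (B : 'M[R]_(m, p)) (x : 'cV[R]_p) :
  euclid (B *m x) ^+ 2 <= opnorm B ^+ 2 * euclid x ^+ 2.
Proof.
rewrite -exprMn lerXn2r ?nnegrE ?mulr_ge0 ?euclid_ge0 ?opnorm_ge0//.
exact: euclid_mulmx.
Qed.

(** The columns of [B] are the images of the unit vectors. *)
Lemma sqr_frob_le m p (B : 'M[R]_(m, p)) :
  frob B ^+ 2 <= p%:R * opnorm B ^+ 2.
Proof.
rewrite sqr_frob exchange_big/= mulr_natl.
rewrite -[p in _ *+ p]card_ord -sumr_const; apply: ler_sum => j _.
have ej : euclid (delta_mx j 0 : 'cV[R]_p) ^+ 2 = 1.
  rewrite sqr_euclid (bigD1 j)//= mxE !eqxx expr1n big1 ?addr0// => i ij.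
  by rewrite mxE (negbTE ij) expr0n.
have := sqr_euclid_mulmx B (delta_mx j 0); rewrite ej mulr1; apply: le_trans.
by rewrite sqr_euclid; apply: ler_sum => i _; rewrite -colE mxE.
Qed.

Lemma sqr_entry_le_frob m p (B : 'M[R]_(m, p)) i j : B i j ^+ 2 <= frob B ^+ 2.
Proof.
rewrite sqr_frob (bigD1 i)//= (bigD1 j)//= -addrA lerDl addr_ge0//.
  by apply: sumr_ge0 => k _; exact: sqr_ge0.
by apply: sumr_ge0 => k _; apply: sumr_ge0 => l _; exact: sqr_ge0.
Qed.

Lemma sqr_add_le (a b : R) : (a + b) ^+ 2 <= 2 * a ^+ 2 + 2 * b ^+ 2.
Proof. by have := sqr_ge0 (a - b); nra. Qed.

Lemma one_plus_sqr_gt0 m (x : 'cV[R]_m) : 0 < 1 + euclid x ^+ 2.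
Proof. by rewrite ltr_pwDl// sqr_ge0. Qed.

Section lipschitz.
Variables (m p : nat) (f : 'cV[R]_m -> 'M[R]_(m, p)).
Hypothesis f_lip : lipschitz_op f.

Lemma lipschitz_frob : exists2 L : R, 0 <= L &
  forall x y, frob (f x - f y) ^+ 2 <= L * euclid (x - y) ^+ 2.
Proof.
have [L Lf] := f_lip; exists (p%:R * L ^+ 2).
  by rewrite mulr_ge0 ?ler0n ?sqr_ge0.
move=> x y; apply: le_trans (sqr_frob_le _) _.
rewrite -mulrA ler_wpM2l ?ler0n// -exprMn lerXn2r ?nnegrE ?opnorm_ge0//.
exact: le_trans (opnorm_ge0 _) (Lf x y).
Qed.

(** Together with [opnorm_le_frob], this bounds both quotients whose suprema
    are [c_op f] and [c_frob f]. *)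
Lemma frob_linear_growth :
  exists K : R, forall x, frob (f x) ^+ 2 / (1 + euclid x ^+ 2) <= K.
Proof.
have [L L0 Lf] := lipschitz_frob.
exists (2 * L + 2 * frob (f 0) ^+ 2) => x.
rewrite ler_pdivrMr ?one_plus_sqr_gt0//.
have : frob (f x) ^+ 2 <= 2 * frob (f x - f 0) ^+ 2 + 2 * frob (f 0) ^+ 2.
  rewrite !sqr_frob !mulr_sumr -big_split; apply: ler_sum => i _ /=.
  rewrite !mulr_sumr -big_split; apply: ler_sum => j _ /=.
  by have := sqr_add_le ((f x - f 0) i j) (f 0 i j); rewrite !mxE subrK.
have := Lf x 0; rewrite subr0.
have := sqr_ge0 (euclid x); have := sqr_ge0 (frob (f 0)).
move: (euclid x ^+ 2) (frob (f 0) ^+ 2) (frob (f x) ^+ 2) => a b c.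
by move: (frob _ ^+ 2) => e; nra.
Qed.

Lemma sqr_frob_le_c_frob x :
  frob (f x) ^+ 2 <= c_frob f * (1 + euclid x ^+ 2).
Proof.
rewrite -ler_pdivrMr ?one_plus_sqr_gt0//; apply: ub_le_sup; last by exists x.
by have [K fK] := frob_linear_growth; exists K => _ [y _ <-]; exact: fK.
Qed.

Lemma opnorm_linear_growth :
  has_ubound (range (fun x => opnorm (f x) ^+ 2 / (1 + euclid x ^+ 2))).
Proof.
have [K fK] := frob_linear_growth; exists K => _ [x _ <-].
apply: le_trans (fK x); rewrite ler_pM2r ?invr_gt0 ?one_plus_sqr_gt0//.
by rewrite lerXn2r ?nnegrE ?opnorm_ge0 ?frob_ge0 ?opnorm_le_frob.
Qed.

Lemma sqr_opnorm_le_c_op x :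
  opnorm (f x) ^+ 2 <= c_op f * (1 + euclid x ^+ 2).
Proof.
rewrite -ler_pdivrMr ?one_plus_sqr_gt0//; apply: ub_le_sup; last by exists x.
exact: opnorm_linear_growth.
Qed.

Lemma c_op_ge0 : 0 <= c_op f.
Proof.
have := sqr_opnorm_le_c_op 0; rewrite euclid0 expr0n addr0 mulr1.
by apply: le_trans; exact: sqr_ge0.
Qed.

Lemma sqr_opnorm_le_lip x y :
  opnorm (f x - f y) ^+ 2 <= lip f ^+ 2 * euclid (x - y) ^+ 2.
Proof.
have [->|xy] := eqVneq x y.
  rewrite !subrr euclid0 expr0n mulr0.
  apply: le_trans (_ : frob (0 : 'M[R]_(m, p)) ^+ 2 <= 0).
    by rewrite lerXn2r ?nnegrE ?opnorm_ge0 ?frob_ge0 ?opnorm_le_frob.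
  rewrite sqr_frob big1// => i _; rewrite big1// => j _.
  by rewrite mxE expr0n.
have xy0 : 0 < euclid (x - y).
  by rewrite lt_neqAle euclid_ge0 eq_sym euclid_eq0 subr_eq0 xy.
rewrite -exprMn.
suff le_lip : opnorm (f x - f y) <= lip f * euclid (x - y).
  rewrite lerXn2r ?nnegrE ?opnorm_ge0//.
  exact: le_trans (opnorm_ge0 _) le_lip.
rewrite -ler_pdivrMr//; apply: ub_le_sup; last by exists (x, y).
have [L Lf] := f_lip; exists L => _ [[u v] /= uv <-].
rewrite ler_pdivrMr// lt_neqAle euclid_ge0 eq_sym euclid_eq0 subr_eq0.
by rewrite uv.
Qed.

End lipschitz.

End norms.

(** * Borel measurability of vector-valued maps *)

Section borel_vectors.
Variables (R : realType) (m : nat).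

Lemma continuous_measurable_borelV (f : 'cV[R]_m -> R) : continuous f ->
  measurable_fun [set: borelV R m] (f : borelV R m -> R).
Proof.
move=> /continuousP cf; apply: (measurability _ (RGenOInfty.measurableE R)).
move=> _ [_ [a ->] <-]; rewrite setTI; apply: sub_sigma_algebra.
exact/cf/interval_open.
Qed.

Lemma ball_colP (x y : 'cV[R]_m) e : 0 < e ->
  ball x e y <-> forall i, `|x i 0 - y i 0| < e.
Proof.
move=> e0; split=> [[_ xy] i|xy]; first exact: xy.
by split=> // i j; rewrite ord1; exact: xy.
Qed.

Variables (d : measure_display) (S : measurableType d) (Y : S -> 'cV[R]_m).

Lemma random_vector_coord : random_vector Y ->
  forall i, measurable_fun [set: S] (fun w => Y w i 0).
Proof.
move=> mY i.
have := @measurableT_comp _ _ _ _ _ _ (fun x : borelV R m => x i 0) _ Y.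
apply => //; apply: continuous_measurable_borelV; exact: coord_continuous.
Qed.

(** Balls of the maximum norm are boxes, and an open set is the union of the
    countably many rational balls that it contains. *)
Lemma measurable_coord_random_vector :
  (forall i, measurable_fun [set: S] (fun w => Y w i 0)) -> random_vector Y.
Proof.
move=> mY; apply: (@measurability _ _ _ (borelV R m) _ _ open) => //.
move=> _ [U oU <-]; rewrite setTI.
pose c (a : 'cV[rat]_m * nat) : 'cV[R]_m := map_mx ratr a.1.
pose b a := ball (c a) a.2.+1%:R^-1.
pose F a := [set w | b a `<=` U /\ b a (Y w)].
have -> : Y @^-1` U = \bigcup_a F a.
  apply/seteqP; split => [w Uw|w [a _ [+ bw]]]; last exact.
  have /nbhs_ballP[e /= e0 eU] : nbhs (Y w) U by exact: open_nbhs_nbhs.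
  have [k ke] : exists k : nat, k.+1%:R^-1 < e / 2.
    have e2 : 0 < e / 2 by rewrite divr_gt0.
    have := near_infty_natSinv_lt (PosNum e2).
    by case=> N _ NH; exists N; exact: (NH N (leqnn N)).
  have k0 : 0 < k.+1%:R^-1 :> R by rewrite invr_gt0.
  have /choice[g gP] : forall i, exists r : rat,
      `|ratr r - Y w i 0| < k.+1%:R^-1.
    move=> i.
    have [r /itvP rP] : exists r, ratr r \in
        `](Y w i 0 - k.+1%:R^-1), (Y w i 0 + k.+1%:R^-1)[.
      by apply: rat_in_itvoo; rewrite ltrD2l gtrN.
    by exists r; rewrite ltr_distl !rP.
  exists (\col_i g i, k) => //; split => [y|].
    move=> /(ball_colP _ _ k0) ay; apply/eU/(ball_colP _ _ e0) => i.
    have := ay i; rewrite /c !mxE => {}ay; have := gP i; rewrite distrC => {}gP.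
    rewrite -(subrK (ratr (g i)) (Y w i 0)) -addrA.
    rewrite (le_lt_trans (ler_normD _ _))// [e in _ < e](splitr e).
    by rewrite ltrD// ?(lt_trans gP)// (lt_trans ay).
  by apply/(ball_colP _ _ k0) => i; rewrite /c !mxE.
apply: countable_bigcupT_measurable => // a.
have [aU|aU] := pselect (b a `<=` U); last first.
  by rewrite (_ : F a = set0)//; apply/seteqP; split => // w [].
have k0 : 0 < a.2.+1%:R^-1 :> R by rewrite invr_gt0.
have -> : F a = \bigcap_(i in [set: 'I_m])
    ((fun w => Y w i 0) @^-1` ball (c a i 0) a.2.+1%:R^-1).
  apply/seteqP; split => [w [_ /(ball_colP _ _ k0) bw] i _|w aw].
    exact: bw.
  by split => //; apply/(ball_colP _ _ k0) => i; exact: aw.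
apply: fin_bigcap_measurable => // i _.
by rewrite -[X in measurable X]setTI; apply: mY => //; exact: measurable_ball.
Qed.

End borel_vectors.

(** * Square-integrable random variables *)

Section square_integrable.
Variables (R : realType) (disp : measure_display) (T : measurableType disp).
Variable P : probability T R.
Implicit Types f g : T -> R.

Definition integrable1 (f : T -> R) := P.-integrable [set: T] (EFin \o f).

Definition integrable2 (f : T -> R) :=
  measurable_fun [set: T] f /\ integrable1 (fun w => f w ^+ 2).

Definition mean (f : T -> R) : R := Rintegral P [set: T] f.

Lemma integrable1_le f g : measurable_fun [set: T] f ->
  (forall w, `|f w| <= g w) -> integrable1 g -> integrable1 f.
Proof.
move=> mf fg; apply: le_integrable => //.
  exact/measurable_EFinP.
by move=> w _ /=; rewrite lee_fin (le_trans (fg w))// ler_norm.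
Qed.

Lemma integrable1D f g : integrable1 f -> integrable1 g ->
  integrable1 (fun w => f w + g w).
Proof. by move=> If Ig; exact: (integrableD measurableT If Ig). Qed.

Lemma integrable1Z (k : R) f : integrable1 f -> integrable1 (fun w => k * f w).
Proof. by move=> If; exact: (integrableZl measurableT k If). Qed.

Lemma integrable1_sum (I : Type) (s : seq I) (f : I -> T -> R) :
  (forall i, integrable1 (f i)) -> integrable1 (fun w => \sum_(i <- s) f i w).
Proof.
move=> If; rewrite /integrable1 /comp; under eq_fun do rewrite -sumEFin.
by apply: integrable_sum => // i _; exact: If.
Qed.

Lemma integrable1_cst (k : R) : integrable1 (fun=> k).
Proof. exact: finite_measure_integrable_cst. Qed.

Lemma eq_mean f g : f =1 g -> mean f = mean g.
Proof. by move=> /funext ->. Qed.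

Lemma meanD f g : integrable1 f -> integrable1 g ->
  mean (fun w => f w + g w) = mean f + mean g.
Proof. by move=> If Ig; rewrite /mean RintegralD. Qed.

Lemma meanZ (k : R) f : integrable1 f -> mean (fun w => k * f w) = k * mean f.
Proof. by move=> If; rewrite /mean RintegralZl. Qed.

Lemma mean_cst (k : R) : mean (fun=> k) = k.
Proof. by rewrite /mean Rintegral_cst//= probability_setT mulr1. Qed.

Lemma mean_sum (I : Type) (s : seq I) (f : I -> T -> R) :
  (forall i, integrable1 (f i)) ->
  mean (fun w => \sum_(i <- s) f i w) = \sum_(i <- s) mean (f i).
Proof.
move=> If; elim: s => [|i s IH].
  by rewrite big_nil -[RHS](mean_cst 0); apply: eq_mean => w; rewrite big_nil.
rewrite big_cons -IH -meanD//; last exact: integrable1_sum.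
by apply: eq_mean => w; rewrite big_cons.
Qed.

Lemma mean_le f g : integrable1 f -> integrable1 g ->
  (forall w, f w <= g w) -> mean f <= mean g.
Proof. by move=> If Ig fg; exact: le_Rintegral. Qed.

Lemma mean_ge0 f : (forall w, 0 <= f w) -> 0 <= mean f.
Proof. by move=> f0; exact: Rintegral_ge0. Qed.

Lemma integral_mean f : integrable1 f -> (\int[P]_w (f w)%:E)%E = (mean f)%:E.
Proof. by move=> If; rewrite fineK//; exact: integrable_fin_num. Qed.

Lemma integrable2_le f g : measurable_fun [set: T] f ->
  (forall w, f w ^+ 2 <= g w) -> integrable1 g -> integrable2 f.
Proof.
move=> mf fg Ig; split => //; apply: integrable1_le Ig.
  exact: measurable_funX.
by move=> w; rewrite ger0_norm ?sqr_ge0.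
Qed.

Lemma integrable2_bounded f (k : R) : measurable_fun [set: T] f ->
  (forall w, f w ^+ 2 <= k) -> integrable2 f.
Proof.
by move=> mf fk; apply: integrable2_le mf fk _; exact: integrable1_cst.
Qed.

Lemma integrable2D f g : integrable2 f -> integrable2 g ->
  integrable2 (fun w => f w + g w).
Proof.
move=> [mf If] [mg Ig].
apply: (@integrable2_le _ (fun w => 2 * f w ^+ 2 + 2 * g w ^+ 2)).
- exact: measurable_funD.
- by move=> w; exact: sqr_add_le.
- by apply: integrable1D; exact: integrable1Z.
Qed.

Lemma integrable2N f : integrable2 f -> integrable2 (fun w => - f w).
Proof.
move=> [mf If]; apply: integrable2_le If => [|w]; first exact: measurable_funN.
by rewrite sqrrN.
Qed.

Lemma integrable2B f g : integrable2 f -> integrable2 g ->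
  integrable2 (fun w => f w - g w).
Proof. by move=> If Ig; apply: integrable2D => //; exact: integrable2N. Qed.

Lemma integrable2_sum (I : Type) (s : seq I) (f : I -> T -> R) :
  (forall i, integrable2 (f i)) -> integrable2 (fun w => \sum_(i <- s) f i w).
Proof.
move=> If; elim: s => [|i s IH].
  under eq_fun do rewrite big_nil.
  by apply: (@integrable2_bounded _ 0) => // w; rewrite expr0n.
by under eq_fun do rewrite big_cons; exact: integrable2D.
Qed.

Lemma integrable2M f g : integrable2 f -> integrable2 g ->
  integrable1 (fun w => f w * g w).
Proof.
move=> [mf If] [mg Ig].
apply: (@integrable1_le _ (fun w => f w ^+ 2 + g w ^+ 2)).
- exact: measurable_funM.
- move=> w; rewrite ler_norml.
  by have := sqr_ge0 (f w - g w); have := sqr_ge0 (f w + g w);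
    have := sqr_ge0 (f w); have := sqr_ge0 (g w) => *; apply/andP; split; nra.
- exact: integrable1D.
Qed.

Lemma integrable21 f : integrable2 f -> integrable1 f.
Proof.
move=> If; have -> : f = (fun w => 1 * f w) by apply/funext => w; rewrite mul1r.
apply: integrable2M => //.
by apply: (@integrable2_bounded _ 1) => // w; rewrite expr1n.
Qed.

Lemma bounded_integrable2 m p (g : 'cV[R]_m -> 'cV[R]_p) (Y : T -> 'cV[R]_m) :
  borel_fun g -> bounded_vfun g -> random_vector Y ->
  forall i, integrable2 (fun w => g (Y w) i 0).
Proof.
move=> mg [M gM] mY i.
apply: (@integrable2_bounded _ (M ^+ 2)) => [|w].
  have := @random_vector_coord _ _ _ _ (fun w => g (Y w)).
  by apply; exact: (measurableT_comp mg mY).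
apply: le_trans (sqr_coord_le _ _) _.
rewrite lerXn2r ?nnegrE ?euclid_ge0//.
exact: le_trans (euclid_ge0 _) (gM (Y w)).
Qed.

End square_integrable.

(** * Independence and expectations of products *)

Section independence.
Variables (R : realType) (disp : measure_display) (T : measurableType disp).
Variable P : probability T R.

(** Independence says that the joint law of [f] and [g] is the product of
    their laws, so the mean of [f * g] is computed by Fubini's theorem. *)
Section joint_law.
Variables f g : T -> R.
Hypotheses (mf : measurable_fun [set: T] f) (mg : measurable_fun [set: T] g).
Hypothesis fg_indep : forall A B : set R, measurable A -> measurable B ->
  P (f @^-1` A `&` g @^-1` B) = (P (f @^-1` A) * P (g @^-1` B))%E.

Let fX : {mfun T >-> R} := mfun_Sub (mem_set mf).
Let gX : {mfun T >-> R} := mfun_Sub (mem_set mg).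
Let mfg : measurable_fun [set: T] (fun w => (f w, g w)).
Proof. exact: measurable_fun_pair. Qed.
Let fgX : {mfun T >-> (R * R)%type} := mfun_Sub (mem_set mfg).
Let law_f := distribution P fX.
Let law_g := distribution P gX.

Lemma joint_lawE (A : set (R * R)) : measurable A ->
  (law_f \x law_g)%E A = distribution P fgX A.
Proof.
by move=> mA; apply: product_measure_unique => // B C; exact: fg_indep.
Qed.

Let mul_EFin (z : R * R) : \bar R := (z.1 * z.2)%:E.

Let measurable_mul : measurable_fun [set: (R * R)%type] mul_EFin.
Proof.
by apply/measurable_EFinP; apply: measurable_funM;
  [exact: measurable_fst|exact: measurable_snd].
Qed.

Hypotheses (If : integrable1 P f) (Ig : integrable1 P g).

Let law_f_int : law_f.-integrable [set: R] EFin.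
Proof. by apply: integrable_pushforward => //; exact: EFin_measurable. Qed.

Let law_g_int : law_g.-integrable [set: R] EFin.
Proof. by apply: integrable_pushforward => //; exact: EFin_measurable. Qed.

Let prod_int : (law_f \x law_g)%E.-integrable [set: (R * R)%type] mul_EFin.
Proof.
apply/integrable12ltyP => //.
have E x : (\int[law_g]_y `|mul_EFin (x, y)| =
    `|x|%:E * \int[law_g]_y `|y%:E|)%E.
  rewrite -ge0_integralZl//; last first.
    by apply: measurableT_comp => //; exact: EFin_measurable.
  by apply: eq_integral => y _; rewrite /mul_EFin/= normrM EFinM.
under eq_integral do rewrite E.
have /integrableP[_ foo] := law_f_int; have /integrableP[_ goo] := law_g_int.
rewrite ge0_integralZr//; last 2 first.
  by apply: measurableT_comp => //; exact: EFin_measurable.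
  exact: integral_ge0.
by rewrite lte_mul_pinfty ?integral_ge0// ge0_fin_numE ?integral_ge0.
Qed.

Lemma integrable1M_indep : integrable1 P (fun w => f w * g w).
Proof.
have /integrableP[_] := prod_int.
rewrite (eq_measure_integral (distribution P fgX)); last first.
  by move=> A mA _; exact: joint_lawE.
rewrite ge0_integral_distribution//; last exact: measurableT_comp.
move=> fgoo; apply/integrableP; split => //.
by apply/measurable_EFinP; exact: measurable_funM.
Qed.

Lemma meanM_indep : mean P (fun w => f w * g w) = mean P f * mean P g.
Proof.
apply: EFin_inj; rewrite EFinM -!integral_mean//; last first.
  exact: integrable1M_indep.
have -> : (\int[P]_w (f w * g w)%:E = \int[distribution P fgX]_z mul_EFin z)%E.
  rewrite integral_distribution//; exact: integrable1M_indep.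
rewrite -(@eq_measure_integral _ _ _ _ _ (law_f \x law_g)%E); last first.
  by move=> A mA _; exact: joint_lawE.
rewrite -integral12_prod_meas1//.
have -> : (\int[P]_w (f w)%:E = \int[law_f]_x x%:E)%E.
  by rewrite integral_distribution//; exact: EFin_measurable.
have -> : (\int[P]_w (g w)%:E = \int[law_g]_x x%:E)%E.
  by rewrite integral_distribution//; exact: EFin_measurable.
have /fineK <- := integrable_fin_num measurableT law_g_int.
rewrite -integralZr//; apply: eq_integral => x _.
rewrite fineK ?integrable_fin_num//.
by rewrite -integralZl.
Qed.

End joint_law.

End independence.

(** * The past of a white noise *)

Section sigma_of_vector.
Variables (R : realType) (disp : measure_display) (T : measurableType disp).

Lemma sigma_of_setT m (Y : T -> 'cV[R]_m) : sigma_of Y [set: T].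
Proof. by exists setT => //; rewrite preimage_setT setIT. Qed.

Lemma sigma_of_setI m (Y : T -> 'cV[R]_m) : setI_closed (sigma_of Y).
Proof.
move=> _ _ [A mA <-] [B mB <-]; exists (A `&` B); first exact: measurableI.
by rewrite !setTI preimage_setI.
Qed.

Lemma measurable_sigma_of m (Y : T -> 'cV[R]_m) :
  random_vector Y -> sigma_of Y `<=` measurable.
Proof. by move=> mY _ [A mA <-]; exact: mY. Qed.

Lemma sigma_of_generated m (Y : T -> 'cV[R]_m) : <<s sigma_of Y >> = sigma_of Y.
Proof.
apply: sigma_algebra_id.
exact: (@sigma_algebra_measurable _ (g_sigma_algebra_preimageType
  (Y : T -> borelV R m))).
Qed.

Lemma random_vector_sub (G : set (set T)) m (Y : T -> 'cV[R]_m) :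
  sigma_of Y `<=` G -> random_vector (Y : g_sigma_algebraType G -> 'cV[R]_m).
Proof.
move=> YG _ B mB; apply: sub_sigma_algebra; apply: YG.
by exists B.
Qed.

Lemma sigma_of_comp m p (g : 'cV[R]_m -> 'cV[R]_p) (Y : T -> 'cV[R]_m) :
  borel_fun g -> sigma_of (fun w => g (Y w)) `<=` sigma_of Y.
Proof.
move=> mg _ [B mB <-]; exists (g @^-1` B); last by [].
by rewrite -[X in measurable X]setTI; exact: mg.
Qed.

Lemma random_vector_measurable (G : set (set T)) m (V : T -> 'cV[R]_m) :
  G `<=` measurable -> random_vector (V : g_sigma_algebraType G -> 'cV[R]_m) ->
  random_vector V.
Proof.
move=> Gm GV _ B mB.
by apply: (smallest_sub (@sigma_algebra_measurable _ T) Gm); exact: GV.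
Qed.

End sigma_of_vector.

Section past.
Variables (R : realType) (disp : measure_display) (T : measurableType disp).
Variables (P : probability T R) (d q n : nat).
Variables (X0 : T -> 'cV[R]_d) (Z : 'I_n -> T -> 'cV[R]_q).

(** A pi-system, rather than the sigma-algebra generated by [X0] and the first
    [k] noises: on these events the product rule can be read off from the
    hypotheses. *)
Definition past (k : nat) : set (set T) :=
  [set C | exists A E, [/\ sigma_of X0 A, forall i, sigma_of (Z i) (E i)
    & C = A `&` \bigcap_(i in [set i : 'I_n | (i < k)%N]) E i]].

Lemma past_setI k : setI_closed (past k).
Proof.
move=> _ _ [A [E [XA ZE ->]]] [B [F [XB ZF ->]]].
exists (A `&` B), (fun i => E i `&` F i); split.
- exact: sigma_of_setI.
- by move=> i; exact: sigma_of_setI.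
- by rewrite bigcapI setIACA.
Qed.

Lemma past_setT k : past k [set: T].
Proof.
exists setT, (fun=> setT); split; [exact: sigma_of_setT| |].
  by move=> i; exact: sigma_of_setT.
by rewrite setTI; apply/seteqP; split.
Qed.

Lemma past_X0 k A : sigma_of X0 A -> past k A.
Proof.
move=> XA; exists A, (fun=> setT); split => //.
  by move=> i; exact: sigma_of_setT.
by rewrite -[LHS]setIT; congr (_ `&` _); apply/seteqP; split.
Qed.

Lemma past_noise k (j : 'I_n) A : (j < k)%N -> sigma_of (Z j) A -> past k A.
Proof.
move=> jk ZA; exists setT, (fun i => if i == j then A else setT); split.
- exact: sigma_of_setT.
- by move=> i; case: eqVneq => [->//|_]; exact: sigma_of_setT.
- rewrite setTI; apply/seteqP; split => [w Aw i _|w /(_ j jk)].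
    by case: eqP.
  by rewrite eqxx.
Qed.

Hypotheses (X0_rv : random_vector X0) (Z_rv : forall i, random_vector (Z i)).

Lemma past_measurable k : past k `<=` measurable.
Proof.
move=> _ [A [E [XA ZE ->]]]; apply: measurableI.
  exact: measurable_sigma_of XA.
by apply: fin_bigcap_measurable => // i _; exact: measurable_sigma_of (ZE i).
Qed.

Hypotheses (Z_indep : mutually_independent P (fun i => sigma_of (Z i)))
  (Z_X0_indep : independent2 P (sigma_of X0) (sigma_of_family Z)).

Lemma sigma_of_family_bigcap (J : {set 'I_n}) (E : 'I_n -> set T) :
  (forall i, i \in J -> sigma_of (Z i) (E i)) ->
  sigma_of_family Z (\bigcap_(i in [set` J]) E i).
Proof.
move=> ZE; apply: (@fin_bigcap_measurable _ (g_sigma_algebraType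
  (\big[setU/set0]_(i < n) sigma_of (Z i)))) => // i /ZE ZEi.
by apply: sub_sigma_algebra; rewrite (bigD1 i)//=; left.
Qed.

(** Independence holds on the pi-system [past k] by the product rule for the
    noises up to [k] and their independence from [X0]; the uniqueness theorem
    for finite measures extends it to the generated sigma-algebra. *)
Lemma past_indep (k : 'I_n) : independent2 P <<s past k >> (sigma_of (Z k)).
Proof.
move=> C B + ZB; have mB := measurable_sigma_of (Z_rv k) ZB.
have PB0 : 0 <= fine (P B) by exact: fine_ge0.
have PBE : (fine (P B))%:E = P B by rewrite fineK// fin_num_measure.
pose m2 := mscale (NngNum PB0) P.
have m2E A : m2 A = (P B * P A)%E by rewrite -PBE.
suff : forall C, <<s past k >> C -> mrestr P mB C = m2 C.
  by move=> /[apply]; rewrite [RHS]m2E muleC.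
apply: (@g_sigma_algebra_measure_unique _ _ _ _ (past_measurable (k := k))
  (fun=> setT)).
- by move=> _; exact: past_setT.
- by rewrite bigcup_const//; exists 0%N.
- exact: past_setI.
- move=> _ [A [E [XA ZE ->]]].
  pose J : {set 'I_n} := [set i : 'I_n | (i < k)%N]%SET.
  have -> : [set i : 'I_n | (i < k)%N]%classic = [set` J].
    by apply/seteqP; split => i /=; rewrite inE.
  pose E' i := if i == k then B else E i.
  have ZE' i : i \in k |: J -> sigma_of (Z i) (E' i).
    by move=> _; rewrite /E'; case: eqVneq => [->|_].
  have kJ : k \notin J by rewrite inE ltnn.
  have EB : \bigcap_(i in [set` J]) E i `&` B =
      \bigcap_(i in [set` (k |: J)%SET]) E' i.
    apply/seteqP; split => [w [Ew Bw] i /=|w Ew].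
      by rewrite !inE /E'; case: eqVneq => //= _ ik; apply: Ew; rewrite /= inE.
    split; last by have := Ew k; rewrite /E' eqxx; apply; rewrite /= !inE eqxx.
    move=> i /= iJ; have := Ew i; rewrite /E' ifN; last first.
      by apply: contraNN kJ => /eqP <-.
    by apply; rewrite /= in_setU1 iJ orbT.
  transitivity (P (A `&` (\bigcap_(i in [set` J]) E i `&` B))).
    by rewrite setIA.
  rewrite EB [RHS]m2E.
  rewrite (Z_X0_indep XA (sigma_of_family_bigcap ZE')).
  rewrite (Z_X0_indep XA (sigma_of_family_bigcap (J := J) (fun i _ => ZE i))).
  rewrite (Z_indep ZE') (Z_indep (J := J) (fun i _ => ZE i)).
  rewrite big_setU1//= {1}/E' eqxx muleCA; congr (_ * (_ * _))%E.
  apply: eq_bigr => i iJ; rewrite /E' ifN//.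
  by apply: contraNN kJ => /eqP <-.
- by move=> _; rewrite /= /mrestr setTI ltey_eq fin_num_measure.
Qed.

End past.

(** * One step of the recursion *)

Section step.
Variables (R : realType) (disp : measure_display) (T : measurableType disp).
Variable P : probability T R.
Implicit Types f g : T -> R.

(** Measurability with respect to [<<s G>>], expressed through the type
    [g_sigma_algebraType G] so that the closure properties of measurable
    functions apply as they stand. *)
Definition adapted (G : set (set T)) f :=
  measurable_fun [set: g_sigma_algebraType G] (f : g_sigma_algebraType G -> R).

Definition adapted2 (G : set (set T)) f := adapted G f /\ integrable2 P f.

Lemma adapted_measurable (G : set (set T)) f :
  G `<=` measurable -> adapted G f -> measurable_fun [set: T] f.
Proof.
move=> Gm Gf _ B mB.
by apply: (smallest_sub (@sigma_algebra_measurable _ T) Gm); exact: Gf.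
Qed.

Lemma adapted2B (G : set (set T)) f g : adapted2 G f -> adapted2 G g ->
  adapted2 G (fun w => f w - g w).
Proof.
move=> [Gf If] [Gg Ig]; split; first exact: measurable_funB.
exact: integrable2B.
Qed.

Lemma measurable_euclid (d' : measure_display) (S : measurableType d') m
    (D : S -> 'cV[R]_m) :
  (forall i, measurable_fun [set: S] (fun w => D w i 0)) ->
  measurable_fun [set: S] (fun w => euclid (D w)).
Proof.
move=> mD; apply: (measurableT_comp (continuous_measurable_fun _)).
  exact: sqrt_continuous.
by apply: measurable_sum => i; apply: measurable_funX; exact: mD.
Qed.

Lemma integrable1_sqr_euclid m (D : T -> 'cV[R]_m) :
  (forall i, integrable2 P (fun w => D w i 0)) ->
  integrable1 P (fun w => euclid (D w) ^+ 2).
Proof.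
move=> ID; under eq_fun do rewrite sqr_euclid.
by apply: integrable1_sum => i; have [] := ID i.
Qed.

Lemma integrable2_euclid m (D : T -> 'cV[R]_m) :
  (forall i, integrable2 P (fun w => D w i 0)) ->
  integrable2 P (fun w => euclid (D w)).
Proof.
move=> ID; split; last exact: integrable1_sqr_euclid.
by apply: measurable_euclid => i; case: (ID i).
Qed.

Lemma mean_sqr_euclid m (D : T -> 'cV[R]_m) :
  (forall i, integrable2 P (fun w => D w i 0)) ->
  mean P (fun w => euclid (D w) ^+ 2) = \sum_i mean P (fun w => D w i 0 ^+ 2).
Proof.
move=> ID; rewrite -mean_sum; last by move=> i; have [] := ID i.
by apply: eq_mean => w; rewrite sqr_euclid.
Qed.

Lemma mean_sqr_orthogonal3 f g (h : T -> R) :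
  integrable2 P f -> integrable2 P g -> integrable2 P h ->
  mean P (fun w => f w * g w) = 0 -> mean P (fun w => f w * h w) = 0 ->
  mean P (fun w => g w * h w) = 0 ->
  mean P (fun w => (f w + g w + h w) ^+ 2) =
  mean P (fun w => f w ^+ 2) + mean P (fun w => g w ^+ 2)
  + mean P (fun w => h w ^+ 2).
Proof.
move=> If Ig Ih fg fh gh.
have Ifg := integrable2M If Ig; have Ifh := integrable2M If Ih.
have Igh := integrable2M Ig Ih.
transitivity (mean P (fun w => f w ^+ 2 + g w ^+ 2 + h w ^+ 2
    + 2 * (f w * g w + f w * h w + g w * h w))).
  by apply: eq_mean => w; ring.
case: If Ig Ih => [_ If] [_ Ig] [_ Ih].
rewrite meanD; [|by do 2?apply: integrable1D|].
  rewrite meanZ; last by do 2?apply: integrable1D.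
  rewrite !meanD//; try exact: integrable1D.
  by rewrite fg fh gh !addr0 mulr0 addr0.
by apply: integrable1Z; do 2?apply: integrable1D.
Qed.

(** [F] generates the past and [H] the sigma-algebra of the next noise. *)
Section independent.
Variables F H : set (set T).
Hypotheses (Fm : F `<=` measurable) (Hm : H `<=` measurable).
Hypothesis FH_indep : independent2 P <<s F >> <<s H >>.

Lemma adapted_indep f g : adapted F f -> adapted H g ->
  forall A B : set R, measurable A -> measurable B ->
  P (f @^-1` A `&` g @^-1` B) = (P (f @^-1` A) * P (g @^-1` B))%E.
Proof.
move=> Ff Hg A B mA mB; apply: FH_indep.
  by rewrite -[X in <<s F >> X]setTI; exact: Ff.
by rewrite -[X in <<s H >> X]setTI; exact: Hg.
Qed.

Lemma integrable1M_adapted f g : adapted F f -> adapted H g ->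
  integrable1 P f -> integrable1 P g -> integrable1 P (fun w => f w * g w).
Proof.
move=> Ff Hg If Ig; apply: integrable1M_indep If Ig.
- exact: adapted_measurable Ff.
- exact: adapted_measurable Hg.
- exact: adapted_indep.
Qed.

Lemma meanM_adapted f g : adapted F f -> adapted H g ->
  integrable1 P f -> integrable1 P g ->
  mean P (fun w => f w * g w) = mean P f * mean P g.
Proof.
move=> Ff Hg If Ig; apply: meanM_indep If Ig.
- exact: adapted_measurable Ff.
- exact: adapted_measurable Hg.
- exact: adapted_indep.
Qed.

Lemma integrable2M_adapted f g : adapted2 F f -> adapted2 H g ->
  integrable2 P (fun w => f w * g w).
Proof.
move=> [Ff [mf If]] [Hg [mg Ig]]; split; first exact: measurable_funM.
under eq_fun do rewrite exprMn.
by apply: integrable1M_adapted => //; exact: measurable_funX.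
Qed.

Variable q : nat.

Lemma integrable2_comb (a x : 'I_q -> T -> R) :
  (forall j, adapted2 F (a j)) -> (forall j, adapted2 H (x j)) ->
  integrable2 P (fun w => \sum_j a j w * x j w).
Proof.
by move=> Fa Hx; apply: integrable2_sum => j; exact: integrable2M_adapted.
Qed.

Lemma mean_mul_comb f (a x : 'I_q -> T -> R) : adapted2 F f ->
  (forall j, adapted2 F (a j)) -> (forall j, adapted2 H (x j)) ->
  mean P (fun w => f w * \sum_j a j w * x j w) =
  \sum_j mean P (fun w => f w * a j w) * mean P (x j).
Proof.
move=> Ff Fa Hx; under eq_mean do rewrite mulr_sumr.
have Fj j : adapted F (fun w => f w * a j w).
  by case: Ff (Fa j) => [Ff _] [Faj _]; exact: measurable_funM.
have Ij j : integrable1 P (fun w => f w * a j w).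
  by case: Ff (Fa j) => [_ ?] [_ ?]; exact: integrable2M.
have Hj j : integrable1 P (x j) by case: (Hx j) => _ /integrable21.
rewrite mean_sum.
  apply: eq_bigr => j _; rewrite -meanM_adapted//; last by case: (Hx j).
  by apply: eq_mean => w; rewrite mulrA.
move=> j; under eq_fun do rewrite mulrA.
by apply: integrable1M_adapted => //; case: (Hx j).
Qed.

Lemma mean_comb_comb (a b x y : 'I_q -> T -> R) :
  (forall j, adapted2 F (a j)) -> (forall j, adapted2 F (b j)) ->
  (forall j, adapted2 H (x j)) -> (forall j, adapted2 H (y j)) ->
  mean P (fun w => (\sum_i a i w * x i w) * \sum_j b j w * y j w) =
  \sum_i \sum_j mean P (fun w => a i w * b j w) *
                mean P (fun w => x i w * y j w).
Proof.
move=> Fa Fb Hx Hy.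
have Fab i j : adapted F (fun w => a i w * b j w).
  by case: (Fa i) (Fb j) => [? _] [? _]; exact: measurable_funM.
have Iab i j : integrable1 P (fun w => a i w * b j w).
  by case: (Fa i) (Fb j) => [_ ?] [_ ?]; exact: integrable2M.
have Hxy i j : adapted H (fun w => x i w * y j w).
  by case: (Hx i) (Hy j) => [? _] [? _]; exact: measurable_funM.
have Ixy i j : integrable1 P (fun w => x i w * y j w).
  by case: (Hx i) (Hy j) => [_ ?] [_ ?]; exact: integrable2M.
have I i j := integrable1M_adapted (Fab i j) (Hxy i j) (Iab i j) (Ixy i j).
transitivity (mean P (fun w => \sum_i \sum_j
    (a i w * b j w) * (x i w * y j w))).
  apply: eq_mean => w; rewrite mulr_suml; apply: eq_bigr => i _.
  by rewrite mulr_sumr; apply: eq_bigr => j _; ring.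
rewrite mean_sum; last by move=> i; exact: integrable1_sum.
apply: eq_bigr => i _; rewrite mean_sum//; apply: eq_bigr => j _.
exact: meanM_adapted.
Qed.

Variable d : nat.
Implicit Types (D : T -> 'cV[R]_d) (A B : T -> 'M[R]_(d, q)).
Implicit Types x y : T -> 'cV[R]_q.

Lemma integrable2_mulmx A x :
  (forall i j, adapted2 F (fun w => A w i j)) ->
  (forall j, adapted2 H (fun w => x w j 0)) ->
  forall i, integrable2 P (fun w => (A w *m x w) i 0).
Proof.
move=> FA Hx i; under eq_fun do rewrite mxE.
exact: (integrable2_comb (FA i) Hx).
Qed.

Lemma integrable2_step D A B x y :
  (forall i, adapted2 F (fun w => D w i 0)) ->
  (forall i j, adapted2 F (fun w => A w i j)) ->
  (forall i j, adapted2 F (fun w => B w i j)) ->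
  (forall j, adapted2 H (fun w => x w j 0)) ->
  (forall j, adapted2 H (fun w => y w j 0)) ->
  forall i, integrable2 P (fun w => (D w + A w *m x w + B w *m y w) i 0).
Proof.
move=> FD FA FB Hx Hy i.
have -> : (fun w => (D w + A w *m x w + B w *m y w) i 0) =
    (fun w => D w i 0 + (A w *m x w) i 0 + (B w *m y w) i 0).
  by apply/funext => w; rewrite !mxE.
apply: integrable2D; last exact: integrable2_mulmx.
by apply: integrable2D; [case: (FD i)|exact: integrable2_mulmx].
Qed.

(** Each cross term is a sum of products of a mean over the past and either the
    mean of a coordinate of a noise or the mean of a product of coordinates of
    [x] and [y]; the latter vanish. *)
Lemma mean_sqr_martingale_step D A B x y :
  (forall i, adapted2 F (fun w => D w i 0)) ->
  (forall i j, adapted2 F (fun w => A w i j)) ->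
  (forall i j, adapted2 F (fun w => B w i j)) ->
  (forall j, adapted2 H (fun w => x w j 0)) ->
  (forall j, adapted2 H (fun w => y w j 0)) ->
  (forall j, mean P (fun w => x w j 0) = 0) ->
  (forall j, mean P (fun w => y w j 0) = 0) ->
  (forall i j, mean P (fun w => x w i 0 * y w j 0) = 0) ->
  mean P (fun w => euclid (D w + A w *m x w + B w *m y w) ^+ 2) =
  mean P (fun w => euclid (D w) ^+ 2)
  + mean P (fun w => euclid (A w *m x w) ^+ 2)
  + mean P (fun w => euclid (B w *m y w) ^+ 2).
Proof.
move=> FD FA FB Hx Hy x0 y0 xy0.
have IAx := integrable2_mulmx FA Hx; have IBy := integrable2_mulmx FB Hy.
have ID i : integrable2 P (fun w => D w i 0) by case: (FD i).
rewrite !mean_sqr_euclid//; last exact: integrable2_step.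
rewrite -!big_split; apply: eq_bigr => i _ /=.
transitivity (mean P (fun w => (D w i 0 + (A w *m x w) i 0
    + (B w *m y w) i 0) ^+ 2)).
  by apply: eq_mean => w; rewrite !mxE.
apply: mean_sqr_orthogonal3 => //.
- under eq_mean do rewrite mxE.
  by rewrite (mean_mul_comb (FD i) (FA i) Hx) big1// => j _; rewrite x0 mulr0.
- under eq_mean do rewrite mxE.
  by rewrite (mean_mul_comb (FD i) (FB i) Hy) big1// => j _; rewrite y0 mulr0.
- under eq_mean do rewrite mxE [(_ *m y _) _ _]mxE.
  rewrite (mean_comb_comb (FA i) (FB i) Hx Hy) big1// => j _.
  by rewrite big1// => k _; rewrite xy0 mulr0.
Qed.

(** The operator norm is used pointwise, and [g] and [|x|^2] are independent. *)
Lemma mean_sqr_mulmx_le A x g (c : R) :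
  (forall i j, adapted2 F (fun w => A w i j)) ->
  (forall j, adapted2 H (fun w => x w j 0)) ->
  adapted F g -> integrable1 P g ->
  (forall w, opnorm (A w) ^+ 2 <= c * g w) ->
  mean P (fun w => euclid (A w *m x w) ^+ 2) <=
  c * mean P g * mean P (fun w => euclid (x w) ^+ 2).
Proof.
move=> FA Hx Fg Ig Ag.
have Ix : integrable1 P (fun w => euclid (x w) ^+ 2).
  by apply: integrable1_sqr_euclid => j; case: (Hx j).
have Hx2 : adapted H (fun w => euclid (x w) ^+ 2).
  by apply: measurable_funX; apply: measurable_euclid => j; case: (Hx j).
rewrite -mulrA -meanM_adapted// -meanZ; last exact: integrable1M_adapted.
apply: mean_le.
- exact/integrable1_sqr_euclid/integrable2_mulmx.
- by apply: integrable1Z; exact: integrable1M_adapted.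
- move=> w; apply: le_trans (sqr_euclid_mulmx _ _) _.
  by rewrite mulrA ler_wpM2r ?sqr_ge0.
Qed.

Lemma mean_sqr_mulmx_white A x :
  (forall i j, adapted2 F (fun w => A w i j)) ->
  (forall j, adapted2 H (fun w => x w j 0)) ->
  (forall i j, mean P (fun w => x w i 0 * x w j 0) = (i == j)%:R) ->
  mean P (fun w => euclid (A w *m x w) ^+ 2) =
  mean P (fun w => frob (A w) ^+ 2).
Proof.
move=> FA Hx xx; rewrite mean_sqr_euclid; last exact: integrable2_mulmx.
under [RHS]eq_mean do rewrite sqr_frob.
have IA i j : integrable1 P (fun w => A w i j ^+ 2) by case: (FA i j) => _ [].
rewrite mean_sum; last by move=> i; exact: integrable1_sum.
apply: eq_bigr => i _; rewrite mean_sum//.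
under eq_mean do rewrite mxE expr2.
rewrite (mean_comb_comb (FA i) (FA i) Hx Hx); apply: eq_bigr => j _.
rewrite (bigD1 j)//= big1 ?addr0.
  by rewrite xx eqxx mulr1; apply: eq_mean => w; rewrite expr2.
by move=> k; rewrite eq_sym xx => /negbTE ->; rewrite mulr0.
Qed.

(** [|D|] is a submartingale: with [u = D / |D|] (and [u = 0] where [D = 0]),
    [|D + N| >= <u, D + N> = |D| + <u, N>], and the last term is centered even
    after multiplication by the predictable weight [f]. *)
Lemma mean_euclid_submartingale f D A B x y :
  adapted2 F f -> (forall w, 0 <= f w) ->
  (forall i, adapted2 F (fun w => D w i 0)) ->
  (forall i j, adapted2 F (fun w => A w i j)) ->
  (forall i j, adapted2 F (fun w => B w i j)) ->
  (forall j, adapted2 H (fun w => x w j 0)) ->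
  (forall j, adapted2 H (fun w => y w j 0)) ->
  (forall j, mean P (fun w => x w j 0) = 0) ->
  (forall j, mean P (fun w => y w j 0) = 0) ->
  mean P (fun w => f w * euclid (D w)) <=
  mean P (fun w => f w * euclid (D w + A w *m x w + B w *m y w)).
Proof.
move=> Ff f0 FD FA FB Hx Hy x0 y0.
have ID i : integrable2 P (fun w => D w i 0) by case: (FD i).
have IAx := integrable2_mulmx FA Hx; have IBy := integrable2_mulmx FB Hy.
have If : integrable2 P f by case: Ff.
pose u w := (euclid (D w))^-1 *: D w.
have uD w : \sum_i u w i 0 * D w i 0 = euclid (D w).
  have -> : \sum_i u w i 0 * D w i 0 = (euclid (D w))^-1 * euclid (D w) ^+ 2.
    rewrite sqr_euclid mulr_sumr; apply: eq_bigr => i _.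
    by rewrite mxE -mulrA -expr2.
  have [->|D0] := eqVneq (euclid (D w)) 0; first by rewrite expr0n mulr0.
  by rewrite expr2 mulKf.
have u1 w : euclid (u w) <= 1.
  rewrite euclidZ normfV ger0_norm ?euclid_ge0//.
  have [->|D0] := eqVneq (euclid (D w)) 0; first by rewrite mulr0 ler01.
  by rewrite mulVf.
have Ffu i : adapted2 F (fun w => f w * u w i 0).
  have Fu : adapted F (fun w => f w * u w i 0).
    case: Ff (FD i) => [Ff _] [FDi _]; apply: measurable_funM => //.
    (* The inverse is measurable as the real power with exponent -1. *)
    have -> : (fun w => u w i 0) = (fun w => euclid (D w) `^ (-1) * D w i 0).
      by apply/funext => w; rewrite mxE powR_inv1// euclid_ge0.
    apply: measurable_funM => //.
    apply: (measurableT_comp (measurable_powR _)).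
    by apply: measurable_euclid => j; case: (FD j).
  split=> //; apply: (@integrable2_le _ _ _ _ _ (fun w => f w ^+ 2)).
  - exact: adapted_measurable Fu.
  - move=> w; rewrite exprMn ler_piMr ?sqr_ge0//.
    apply: le_trans (sqr_coord_le _ _) _.
    by rewrite exprn_ile1 ?euclid_ge0.
  - by case: If.
have IfN (C : T -> 'M[R]_(d, q)) (z : T -> 'cV[R]_q) :
    (forall i j, adapted2 F (fun w => C w i j)) ->
    (forall j, adapted2 H (fun w => z w j 0)) ->
  forall i, integrable1 P (fun w => f w * u w i 0 * (C w *m z w) i 0).
  move=> FC Hz i; apply: integrable2M; last exact: integrable2_mulmx.
  by case: (Ffu i).
have fN0 (C : T -> 'M[R]_(d, q)) (z : T -> 'cV[R]_q) :
    (forall i j, adapted2 F (fun w => C w i j)) ->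
    (forall j, adapted2 H (fun w => z w j 0)) ->
    (forall j, mean P (fun w => z w j 0) = 0) ->
  mean P (fun w => \sum_i f w * u w i 0 * (C w *m z w) i 0) = 0.
  move=> FC Hz z0; rewrite mean_sum; last exact: IfN.
  rewrite big1// => i _; under eq_mean do rewrite [(C _ *m _) _ _]mxE.
  by rewrite (mean_mul_comb (Ffu i) (FC i) Hz) big1// => j _; rewrite z0 mulr0.
have IfD : integrable1 P (fun w => f w * euclid (D w)).
  by apply: integrable2M => //; exact: integrable2_euclid.
have IA := integrable1_sum (index_enum _) (IfN A x FA Hx).
have IB := integrable1_sum (index_enum _) (IfN B y FB Hy).
have -> : mean P (fun w => f w * euclid (D w)) =
    mean P (fun w => f w * euclid (D w)
      + \sum_i f w * u w i 0 * (A w *m x w) i 0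
      + \sum_i f w * u w i 0 * (B w *m y w) i 0).
  by rewrite !meanD ?fN0 ?addr0//; exact: integrable1D.
apply: mean_le.
- by apply: integrable1D => //; exact: integrable1D.
- apply: integrable2M => //; apply: integrable2_euclid.
  exact: integrable2_step.
move=> w; have := dot_le_euclid (u w) (D w + A w *m x w + B w *m y w).
move=> /le_trans -/(_ (euclid (D w + A w *m x w + B w *m y w))).
rewrite ler_piMl ?euclid_ge0// => /(_ isT) /(ler_wpM2l (f0 w)).
apply: le_trans; rewrite -uD !mulr_sumr -!big_split/=; apply: ler_sum => i _.
have -> : (D w + A w *m x w + B w *m y w) i 0 =
    D w i 0 + (A w *m x w) i 0 + (B w *m y w) i 0 by rewrite !mxE.
by lra.
Qed.

End independent.
End step.

(** * Extended-real norms and real means *)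

Section norms_as_means.
Variables (R : realType) (disp : measure_display) (T : measurableType disp).
Variable P : probability T R.

Lemma Lnorm2_sqr (f : T -> R) : integrable2 P f ->
  ('N[P]_2%:E[(fun w => (f w)%:E)] ^+ 2 = (mean P (fun w => f w ^+ 2))%:E)%E.
Proof.
move=> [mf If]; rewrite unlock.
under eq_integral do
  rewrite /= -[2%R]/(2%:R) powR_mulrn ?normr_ge0// real_normK ?num_real//.
rewrite integral_mean// poweR_EFin powR12_sqrt ?mean_ge0//; last first.
  by move=> w; exact: sqr_ge0.
rewrite -EFin_expe sqr_sqrtr// mean_ge0// => w; exact: sqr_ge0.
Qed.

Lemma L2norm_sqr m (Y : T -> 'cV[R]_m) :
  (forall i, integrable2 P (fun w => Y w i 0)) ->
  (L2norm P Y ^+ 2 = (mean P (fun w => euclid (Y w) ^+ 2)%R)%:E)%E.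
Proof. by move=> IY; apply/Lnorm2_sqr/integrable2_euclid. Qed.

Lemma L2norm_integrable2 m (Y : T -> 'cV[R]_m) :
  random_vector Y -> (L2norm P Y < +oo)%E ->
  forall i, integrable2 P (fun w => Y w i 0).
Proof.
move=> Y_rv Yoo i; have mY := random_vector_coord Y_rv.
apply: (@integrable2_le _ _ _ _ _ (fun w => euclid (Y w) ^+ 2)) => //.
  by move=> w; exact: sqr_coord_le.
have mE := measurable_euclid mY.
apply/integrableP; split.
  by apply/measurable_EFinP; exact: measurable_funX.
have := poweR_lty 2 Yoo; rewrite poweR_Lnorm ?pnatr_eq0//.
apply: le_lt_trans; apply: ge0_le_integral => //.
- apply: measurableT_comp => //; apply/measurable_EFinP.
  exact: measurable_funX.
- apply/measurable_EFinP/(measurableT_comp (measurable_powR _)).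
  exact: measurableT_comp.
- move=> w _ /=; rewrite lee_fin -[2%R]/(2%:R) powR_mulrn ?normr_ge0//.
  by rewrite normrX.
Qed.

Lemma mean_expectation (f : T -> R) (r : R) :
  ('E_P[f] = r%:E)%E -> mean P f = r.
Proof. by rewrite unlock /mean /Rintegral => ->. Qed.

Lemma mean_covariance (f g : T -> R) (r : R) :
  ('E_P[f] = 0)%E -> ('E_P[g] = 0)%E -> covariance P f g = r%:E ->
  mean P (fun w => f w * g w) = r.
Proof.
rewrite covariance.unlock => -> -> fg; apply: mean_expectation.
rewrite -fg; congr ('E_P[_])%E; apply/funext => w.
by rewrite /= !fctE /= !subr0.
Qed.

End norms_as_means.

(** * Adapted solutions of the recursion *)

Section lipschitz_coefficient.
Variables (R : realType) (d q : nat) (f : 'cV[R]_d -> 'M[R]_(d, q)).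
Hypothesis f_lip : lipschitz_op f.

Lemma lipschitz_continuous i j : continuous (fun x => f x i j).
Proof.
have [L L0 Lf] := lipschitz_frob f_lip => x A /nbhs_ballP[e /= e0 eA].
(* [r] is chosen so that [L d r^2 < e^2]. *)
pose K := L * d%:R; have K0 : 0 <= K by rewrite mulr_ge0 ?ler0n.
have K1 : 0 < K + 1 by rewrite ltr_wpDl.
pose r := e / (K + 1); have r0 : 0 < r by rewrite divr_gt0.
apply/nbhs_ballP; exists r => //= y /(ball_colP _ _ r0) xy; apply: eA.
rewrite /ball/=.
rewrite -(@ltr_pXn2r _ 2%N) ?nnegrE ?normr_ge0 ?ltW//.
rewrite real_normK ?num_real//.
have -> : f x i j - f y i j = (f x - f y) i j by rewrite !mxE.
apply: le_lt_trans (sqr_entry_le_frob _ _ _) _.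
apply: le_lt_trans (Lf x y) _.
have : euclid (x - y) ^+ 2 <= d%:R * r ^+ 2.
  rewrite sqr_euclid mulr_natl -[d in _ *+ d]card_ord -sumr_const.
  apply: ler_sum => k _; rewrite -[leLHS]real_normK ?num_real//.
  by rewrite lerXn2r ?nnegrE ?normr_ge0 ?ltW// !mxE.
move=> /(ler_wpM2l L0)/le_lt_trans; apply; rewrite mulrA -/K.
have -> : e = r * (K + 1) by rewrite /r divfK ?gt_eqF.
have r2 : 0 < r ^+ 2 by rewrite exprn_gt0.
by rewrite [ltRHS]exprMn mulrC ltr_pM2l//; nra.
Qed.

Lemma measurable_coefficient (d' : measure_display) (S : measurableType d')
    (X : S -> 'cV[R]_d) : random_vector X ->
  forall i j, measurable_fun [set: S] (fun w => f (X w) i j).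
Proof.
move=> mX i j.
have := @measurableT_comp _ _ _ _ _ _ (fun x : borelV R d => f x i j) _ X.
apply => //; apply: continuous_measurable_borelV; exact: lipschitz_continuous.
Qed.

Lemma random_vector_step (d' : measure_display) (S : measurableType d')
    (X : S -> 'cV[R]_d) (x : S -> 'cV[R]_q) :
  random_vector X -> random_vector x ->
  random_vector (fun w => X w + f (X w) *m x w).
Proof.
move=> mX mx; apply: measurable_coord_random_vector => i.
have -> : (fun w => (X w + f (X w) *m x w) i 0) =
    (fun w => X w i 0 + \sum_j f (X w) i j * x w j 0).
  by apply/funext => w; rewrite !mxE.
apply: measurable_funD; first exact: random_vector_coord.
apply: measurable_sum => j; apply: measurable_funM.
  exact: measurable_coefficient.
exact: random_vector_coord.
Qed.

Lemma integrable2_coefficient (disp : measure_display)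
    (T : measurableType disp) (P : probability T R) (X : T -> 'cV[R]_d) :
  random_vector X -> (forall i, integrable2 P (fun w => X w i 0)) ->
  forall i j, integrable2 P (fun w => f (X w) i j).
Proof.
move=> mX IX i j.
apply: (@integrable2_le _ _ _ _ _
    (fun w => c_frob f * (1 + euclid (X w) ^+ 2))).
- exact: measurable_coefficient.
- by move=> w; apply: le_trans (sqr_entry_le_frob _ _ _) _;
    exact: sqr_frob_le_c_frob.
- apply: integrable1Z; apply: integrable1D; first exact: integrable1_cst.
  exact: integrable1_sqr_euclid.
Qed.

End lipschitz_coefficient.

Section noise_driven.
Variables (R : realType) (disp : measure_display) (T : measurableType disp).
Variables (P : probability T R) (d q n : nat).
Variables (X0 : T -> 'cV[R]_d) (Z : nat -> T -> 'cV[R]_q).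
Hypotheses (X0_rv : random_vector X0)
  (Z_rv : forall k : 'I_n, random_vector (Z k.+1))
  (Z_indep : mutually_independent P (fun k : 'I_n => sigma_of (Z k.+1)))
  (Z_X0_indep : independent2 P (sigma_of X0)
                  (sigma_of_family (fun k : 'I_n => Z k.+1))).

Local Notation F := (past X0 (fun k : 'I_n => Z k.+1)).

Lemma noise_indep k : (k < n)%N ->
  independent2 P <<s F k >> <<s sigma_of (Z k.+1) >>.
Proof.
move=> kn; rewrite sigma_of_generated.
exact: (past_indep X0_rv Z_rv Z_indep Z_X0_indep (k := Ordinal kn)).
Qed.

Variables (theta : nat -> 'cV[R]_d -> 'M[R]_(d, q)).
Hypothesis theta_lip : forall k, (k < n)%N -> lipschitz_op (theta k).
Variables (Y : nat -> T -> 'cV[R]_d) (x : nat -> T -> 'cV[R]_q).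
Hypotheses (Y0_X0 : sigma_of (Y 0%N) `<=` sigma_of X0)
  (x_Z : forall k, (k < n)%N -> sigma_of (x k.+1) `<=` sigma_of (Z k.+1))
  (YE : forall k, (k < n)%N -> forall w,
    Y k.+1 w = Y k w + theta k (Y k w) *m x k.+1 w).

Lemma solution_adapted k j : (j <= k)%N -> (k <= n)%N ->
  random_vector (Y j : g_sigma_algebraType (F k) -> 'cV[R]_d).
Proof.
move=> + kn; elim: j => [_|j IH jk].
  by apply: random_vector_sub => A /Y0_X0; exact: past_X0.
have jn := leq_trans jk kn.
have -> : Y j.+1 = (fun w => Y j w + theta j (Y j w) *m x j.+1 w).
  by apply/funext => w; exact: YE.
apply: (random_vector_step (theta_lip jn)); first exact: IH (ltnW jk).
apply: random_vector_sub => A /(x_Z jn).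
exact: (@past_noise _ _ _ _ _ _ _ _ _ (Ordinal jn)).
Qed.

Hypotheses (Y0_int : forall i, integrable2 P (fun w => Y 0%N w i 0))
  (x_int : forall k, (k < n)%N -> forall j,
    integrable2 P (fun w => x k.+1 w j 0)).

Let Fm k : F k `<=` measurable.
Proof. by apply: past_measurable. Qed.

Let Zm k : (k < n)%N -> sigma_of (Z k.+1) `<=` measurable.
Proof. by move=> kn; exact: measurable_sigma_of (Z_rv (Ordinal kn)). Qed.

Lemma noise_adapted2 k : (k < n)%N ->
  forall j, adapted2 P (sigma_of (Z k.+1)) (fun w => x k.+1 w j 0).
Proof.
move=> kn j; split; last exact: x_int.
by apply: random_vector_coord; apply: random_vector_sub; exact: x_Z.
Qed.

(** The coefficient and the noise are independent, so their product is square
    integrable as soon as each factor is. *)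
Lemma solution_integrable2 k : (k <= n)%N ->
  forall i, integrable2 P (fun w => Y k w i 0).
Proof.
elim: k => [//|k IH kn i].
have IYk := IH (ltnW kn); have FYk := solution_adapted (leqnn k) (ltnW kn).
have -> : (fun w => Y k.+1 w i 0) =
    (fun w => Y k w i 0 + (theta k (Y k w) *m x k.+1 w) i 0).
  by apply/funext => w; rewrite YE// mxE.
apply: integrable2D => //.
apply: (integrable2_mulmx (Fm (k := k)) (Zm kn) (noise_indep kn)) => [a b|].
  split; first exact: (measurable_coefficient (theta_lip kn) FYk).
  apply: (integrable2_coefficient (theta_lip kn)) => //.
  exact: random_vector_measurable FYk.
exact: noise_adapted2.
Qed.

Lemma solution_adapted2 k j : (j <= k)%N -> (k <= n)%N ->
  forall i, adapted2 P (F k) (fun w => Y j w i 0).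
Proof.
move=> jk kn i; split; last exact: solution_integrable2 (leq_trans jk kn) i.
exact: random_vector_coord (solution_adapted jk kn) i.
Qed.

Lemma coefficient_adapted2 k : (k < n)%N ->
  forall i j, adapted2 P (F k) (fun w => theta k (Y k w) i j).
Proof.
move=> kn i j; have FYk := solution_adapted (leqnn k) (ltnW kn).
split; first exact: (measurable_coefficient (theta_lip kn) FYk).
apply: (integrable2_coefficient (theta_lip kn)).
  exact: random_vector_measurable FYk.
exact: solution_integrable2 (ltnW kn).
Qed.

End noise_driven.

Lemma bigmax_ord_recr (R : realDomainType) (a : R) m (f : nat -> R) :
  \big[Num.max/a]_(j < m.+1) f j =
  Num.max (\big[Num.max/a]_(j < m) f j) (f m).
Proof.
apply/le_anti/andP; split.
  apply/bigmax_leP; split=> [|i _]; first by rewrite le_max bigmax_ge_id.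
  rewrite le_max; have [im|mi] := ltnP i m.
    by rewrite (le_bigmax _ (fun j : 'I_m => f j) (Ordinal im)).
  have -> : i = m :> nat by apply/eqP; rewrite eqn_leq mi -ltnS ltn_ord.
  by rewrite lexx orbT.
rewrite ge_max (le_bigmax _ (fun j : 'I_m.+1 => f j) ord_max) andbT.
apply/bigmax_leP; split=> [|i _]; first exact: bigmax_ge_id.
exact: (le_bigmax _ (fun j : 'I_m.+1 => f j) (widen_ord (leqnSn m) i)).
Qed.

(** * Doob's maximal inequality in mean square *)

Section doob.
Variables (R : realType) (disp : measure_display) (T : measurableType disp).
Variables (P : probability T R) (n : nat) (G : nat -> set (set T)).
Variable S : nat -> T -> R.
Hypotheses (Gm : forall k, G k `<=` measurable)
  (S_adapted : forall k j, (j <= k)%N -> (k <= n)%N -> adapted2 P (G k) (S j))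
  (S_ge0 : forall k w, 0 <= S k w)
  (S_sub : forall k f, (k < n)%N -> adapted2 P (G k) f ->
    (forall w, 0 <= f w) ->
    mean P (fun w => f w * S k w) <= mean P (fun w => f w * S k.+1 w)).

Let M k w := \big[Num.max/0]_(j < k.+1) S j w.

Lemma running_max_adapted2 k : (k <= n)%N -> adapted2 P (G k) (M k).
Proof.
move=> kn; suff GM m : (m <= k.+1)%N ->
    adapted2 P (G k) (fun w => \big[Num.max/0]_(j < m) S j w) by exact: GM.
elim: m => [_|m IH mk].
  under eq_fun do rewrite big_ord0.
  split; first exact: measurable_cst.
  by apply: (@integrable2_bounded _ _ _ _ _ 0) => // w; rewrite expr0n.
under eq_fun => w do rewrite (bigmax_ord_recr _ _ (fun j => S j w)).
have [GMm [_ IM]] := IH (ltnW mk).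
have [GS [_ IS]] := S_adapted (mk : (m <= k)%N) kn.
have GMS := measurable_maxr GMm GS; split=> //.
apply: (@integrable2_le _ _ _ _ _
    (fun w => (\big[Num.max/0]_(j < m) S j w) ^+ 2 + S m w ^+ 2)).
- exact: adapted_measurable GMS.
- by move=> w; case: (leP _ (S m w)) => _; rewrite ?lerDl ?lerDr sqr_ge0.
- exact: integrable1D.
Qed.

Lemma running_maxS k w : M k.+1 w = Num.max (M k w) (S k.+1 w).
Proof. exact: (bigmax_ord_recr _ _ (fun j => S j w)). Qed.

Lemma running_max_ge0 k w : 0 <= M k w.
Proof.
elim: k => [|k IH]; last by rewrite running_maxS le_max IH.
by rewrite /M (bigmax_ord_recr _ _ (fun j => S j w)) le_max S_ge0 orbT.
Qed.

(** From [k] to [k.+1] the mean increases in two moves. Replacing [S k] by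
    [S k.+1] is the submartingale property with the weight [M k]. Replacing
    [M k] by [M k.+1] changes the variable only where the new maximum is
    [S k.+1], and there the gain is the square of [S k.+1 - M k]. *)
Lemma running_max_drift k : (k <= n)%N ->
  0 <= mean P (fun w => 2 * (M k w * S k w) - M k w ^+ 2).
Proof.
have IMS j : (j <= n)%N -> forall l, (l <= n)%N ->
    integrable1 P (fun w => 2 * (M j w * S l w)).
  move=> jn l ln; apply/integrable1Z/integrable2M.
    by case: (running_max_adapted2 jn).
  by case: (S_adapted (leqnn l) ln).
have INM j : (j <= n)%N -> integrable1 P (fun w => - M j w ^+ 2).
  move=> jn; have [_ [_ IM]] := running_max_adapted2 jn.
  have -> : (fun w => - M j w ^+ 2) = (fun w => -1 * M j w ^+ 2).
    by apply/funext => w; rewrite mulN1r.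
  exact: integrable1Z.
elim: k => [_|k IH kn1].
  apply: mean_ge0 => w.
  rewrite /M (bigmax_ord_recr _ _ (fun j => S j w)) big_ord0 max_r//.
  by have := sqr_ge0 (S 0%N w); rewrite !expr2; nra.
have kn := ltnW kn1; apply: le_trans (IH kn) _.
apply: (@le_trans _ _ (mean P (fun w => 2 * (M k w * S k.+1 w) - M k w ^+ 2))).
  rewrite !meanD ?lerD2r; try exact: INM; try exact: IMS.
  have IMSk l : (l <= n)%N -> integrable1 P (fun w => M k w * S l w).
    move=> ln; apply: integrable2M; first by case: (running_max_adapted2 kn).
    by case: (S_adapted (leqnn l) ln).
  rewrite !meanZ ?ler_pM2l//; try exact: IMSk.
  apply: S_sub => //; first exact: running_max_adapted2.
  exact: running_max_ge0.
apply: mean_le.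
- by apply: integrable1D; [exact: IMS|exact: INM].
- by apply: integrable1D; [exact: IMS|exact: INM].
- move=> w; rewrite running_maxS; case: (leP (M k w)) => _ //.
  by have := sqr_ge0 (S k.+1 w - M k w); nra.
Qed.

Lemma doob_mean_square :
  mean P (fun w => M n w ^+ 2) <= 4 * mean P (fun w => S n w ^+ 2).
Proof.
have [_ [mM IM]] := running_max_adapted2 (leqnn n).
have [_ [mS IS]] := S_adapted (leqnn n) (leqnn n).
have : mean P (fun w => 2 * (M n w * S n w) - M n w ^+ 2) <=
    mean P (fun w => 2 * S n w ^+ 2 + - 2^-1 * M n w ^+ 2).
  apply: mean_le.
  - have -> : (fun w => 2 * (M n w * S n w) - M n w ^+ 2) =
        (fun w => 2 * (M n w * S n w) + -1 * M n w ^+ 2).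
      by apply/funext => w; rewrite mulN1r.
    apply: integrable1D; last exact: integrable1Z.
    by apply/integrable1Z/integrable2M.
  - by apply: integrable1D; exact: integrable1Z.
  - by move=> w; have := sqr_ge0 (2 * S n w - M n w); nra.
move/(le_trans (running_max_drift (leqnn n))).
rewrite meanD ?meanZ//; try exact: integrable1Z.
by lra.
Qed.

End doob.

(** * The quantization error *)

(** The bound on [v] has growth rates [K] while [a] has growth rates [L]; taking
    the maximum of the two lets one product carry the error injected at every
    step. *)
Lemma discrete_gronwall (R : realDomainType) n (a v z L K c : nat -> R) :
  (forall k, (k < n)%N -> 0 <= L k) -> (forall k, (k < n)%N -> 0 <= c k) ->
  (forall k, 0 <= z k) -> (forall k, (k <= n)%N -> 0 <= v k) ->
  (forall k, (k < n)%N -> a k.+1 <= a k * (1 + L k) + c k * v k * z k.+1) ->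
  (forall k, (k < n)%N -> v k.+1 <= v k * (1 + K k)) ->
  forall k, (k <= n)%N ->
  a k <= a 0%N * \prod_(1 <= i < k.+1) (1 + L i.-1)
         + v 0%N * \prod_(1 <= i < k.+1) (1 + Num.max (L i.-1) (K i.-1))
           * \sum_(1 <= l < k.+1) c l.-1 * z l.
Proof.
move=> L0 c0 z0 v0 aS vS; pose C k := Num.max (L k) (K k).
have C0 k : (k < n)%N -> 0 <= C k by move=> kn; rewrite /C le_max L0.
have v_le k : (k <= n)%N -> v k <= v 0%N * \prod_(1 <= i < k.+1) (1 + C i.-1).
  elim: k => [_|k IH kn]; first by rewrite big_geq ?mulr1.
  rewrite big_nat_recr//= mulrA; apply: le_trans (vS _ kn) _.
  apply: (@le_trans _ _ (v k * (1 + C k))).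
    by rewrite ler_wpM2l ?v0 ?(ltnW kn)// lerD2l /C le_max lexx orbT.
  by rewrite ler_wpM2r ?IH ?(ltnW kn)// addr_ge0 ?C0.
elim=> [_|k IH kn]; first by rewrite !big_geq// mulr1 mulr0 addr0.
rewrite !(@big_nat_recr _ _ _ k.+1 1)//=.
have := v_le k (ltnW kn); have := IH (ltnW kn); have := aS _ kn.
rewrite -/(C k).
have pred_lt i : (0 < i < k.+1)%N -> (i.-1 < n)%N.
  by move=> /andP[i0 ik]; rewrite prednK// ltnW// (leq_trans ik).
have P0 : 0 <= \prod_(1 <= i < k.+1) (1 + C i.-1).
  rewrite big_nat_cond prodr_ge0// => i; rewrite andbT => /pred_lt ik.
  by rewrite addr_ge0// C0.
have S0 : 0 <= \sum_(1 <= l < k.+1) c l.-1 * z l.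
  rewrite big_nat_cond sumr_ge0// => i; rewrite andbT => /pred_lt ik.
  by rewrite mulr_ge0// c0.
have LC : L k <= C k by rewrite /C le_max lexx.
move: (L0 k kn) (C0 k kn) (mulr_ge0 (c0 k kn) (z0 k.+1)) (v0 0%N (leq0n _)).
move: P0 S0 LC.
move: (\prod_(1 <= i < k.+1) (1 + L i.-1)) (\prod_(1 <= i < k.+1) _).
move: (\sum_(1 <= l < k.+1) _) (L k) (C k) => S Lk Ck p1 p2.
move: (c k) (z k.+1) (v k) (v 0%N) (a 0%N) (a k) (a k.+1).
move=> ck zk vk V A ak ak1.
move=> P0 S0 LC L0' C0' cz V0 aS' IH' vle.
apply: (le_trans aS').
apply: (@le_trans _ _ ((A * p1 + V * p2 * S) * (1 + Lk) + V * p2 * (ck * zk))).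
  rewrite lerD//; first by rewrite ler_wpM2r// addr_ge0.
  by rewrite mulrAC mulrC ler_wpM2r.
have VP0 : 0 <= V * p2 by rewrite mulr_ge0.
have h1 : 0 <= V * p2 * S * (Ck - Lk) by rewrite !mulr_ge0// subr_ge0.
have h2 : 0 <= V * p2 * (ck * zk) * Ck by rewrite mulr_ge0// mulr_ge0.
rewrite -subr_ge0; have -> : A * (p1 * (1 + Lk)) +
    V * (p2 * (1 + Ck)) * (S + ck * zk) -
    ((A * p1 + V * p2 * S) * (1 + Lk) + V * p2 * (ck * zk)) =
    V * p2 * S * (Ck - Lk) + V * p2 * (ck * zk) * Ck by ring.
exact: addr_ge0.
Qed.

Section quantization.
Variables (R : realType) (disp : measure_display) (T : measurableType disp).
Variables (P : probability T R) (d q n : nat).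
Variables (theta : nat -> 'cV[R]_d -> 'M[R]_(d, q)).
Hypothesis theta_lip : forall k, (k < n)%N -> lipschitz_op (theta k).
Variables (X Xb : nat -> T -> 'cV[R]_d) (Z Zb : nat -> T -> 'cV[R]_q).
Hypotheses (X0_rv : random_vector (X 0%N)) (X0_L2 : (L2norm P (X 0%N) < +oo)%E)
  (Z_noise : white_noise P (fun k : 'I_n => Z k.+1))
  (Z_X0_indep : independent2 P (sigma_of (X 0%N))
                  (sigma_of_family (fun k : 'I_n => Z k.+1))).
Variable phi : nat -> 'cV[R]_q -> 'cV[R]_q.
Hypotheses
  (phi_borel : forall k, (1 <= k <= n)%N -> borel_fun (phi k))
  (phi_bounded : forall k, (1 <= k <= n)%N -> bounded_vfun (phi k))
  (ZbE : forall k, (1 <= k <= n)%N -> forall w, Zb k w = phi k (Z k w))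
  (Zb_centered : forall k, (1 <= k <= n)%N ->
    forall i, ('E_P[(fun w => Zb k w i 0)%R] = 0)%E)
  (Zb_orth : forall k, (1 <= k <= n)%N -> forall i j,
    ('E_P[(fun w => (Z k w i 0 - Zb k w i 0) * Zb k w j 0)%R] = 0)%E).
Variable g0 : 'cV[R]_d -> 'cV[R]_d.
Hypotheses (g0_borel : borel_fun g0) (g0_bounded : bounded_vfun g0)
  (Xb0E : forall w, Xb 0%N w = g0 (X 0%N w))
  (XE : forall k, (k < n)%N -> forall w,
    X k.+1 w = X k w + theta k (X k w) *m Z k.+1 w)
  (XbE : forall k, (k < n)%N -> forall w,
    Xb k.+1 w = Xb k w + theta k (Xb k w) *m Zb k.+1 w).

Local Notation F := (past (X 0%N) (fun k : 'I_n => Z k.+1)).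
Local Notation H k := (sigma_of (Z k.+1)).

Lemma Z_rv (k : 'I_n) : random_vector (Z k.+1).
Proof. by case: Z_noise. Qed.

Lemma Z_indep : mutually_independent P (fun k : 'I_n => sigma_of (Z k.+1)).
Proof. by case: Z_noise. Qed.

Lemma Z_int k : (k < n)%N -> forall j, integrable2 P (fun w => Z k.+1 w j 0).
Proof.
move=> kn; case: Z_noise => Z_rv _ Z_L2 _ _.
exact: L2norm_integrable2 (Z_rv (Ordinal kn)) (Z_L2 (Ordinal kn)).
Qed.

Lemma Zb_int k : (k < n)%N -> forall j, integrable2 P (fun w => Zb k.+1 w j 0).
Proof.
move=> kn j; under eq_fun do rewrite ZbE//.
apply: bounded_integrable2; [exact: phi_borel|exact: phi_bounded|].
exact: (Z_rv (Ordinal kn)).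
Qed.

Lemma Xb0_int i : integrable2 P (fun w => Xb 0%N w i 0).
Proof. by under eq_fun do rewrite Xb0E; exact: bounded_integrable2. Qed.

Lemma X0_int i : integrable2 P (fun w => X 0%N w i 0).
Proof. exact: L2norm_integrable2. Qed.

Lemma Zb_sub k : (k < n)%N -> sigma_of (Zb k.+1) `<=` H k.
Proof.
move=> kn; rewrite (funext (ZbE (k := k.+1) kn)).
exact: sigma_of_comp (phi_borel _).
Qed.

Lemma Xb0_sub : sigma_of (Xb 0%N) `<=` sigma_of (X 0%N).
Proof. by rewrite (funext Xb0E); exact: sigma_of_comp. Qed.

Let FH_indep k (kn : (k < n)%N) : independent2 P <<s F k>> <<s H k>> :=
  noise_indep X0_rv Z_rv Z_indep Z_X0_indep kn.

Let Fm k : F k `<=` measurable := past_measurable X0_rv Z_rv (k := k).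

Let Hm k : (k < n)%N -> H k `<=` measurable.
Proof. by move=> kn; exact: measurable_sigma_of (Z_rv (Ordinal kn)). Qed.

Let X_adapted2 k j : (j <= k)%N -> (k <= n)%N ->
  forall i, adapted2 P (F k) (fun w => X j w i 0).
Proof.
exact: (solution_adapted2 X0_rv Z_rv Z_indep Z_X0_indep theta_lip
  (@subset_refl _ _) (fun k _ => @subset_refl _ (H k)) XE X0_int Z_int).
Qed.

Let Xb_adapted2 k j : (j <= k)%N -> (k <= n)%N ->
  forall i, adapted2 P (F k) (fun w => Xb j w i 0).
Proof.
exact: (solution_adapted2 X0_rv Z_rv Z_indep Z_X0_indep theta_lip
  Xb0_sub Zb_sub XbE Xb0_int Zb_int).
Qed.

Let A_adapted2 k : (k < n)%N ->
  forall i j, adapted2 P (F k) (fun w => theta k (X k w) i j).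
Proof.
exact: (coefficient_adapted2 X0_rv Z_rv Z_indep Z_X0_indep theta_lip
  (@subset_refl _ _) (fun k _ => @subset_refl _ (H k)) XE X0_int Z_int).
Qed.

Let Ab_adapted2 k : (k < n)%N ->
  forall i j, adapted2 P (F k) (fun w => theta k (Xb k w) i j).
Proof.
exact: (coefficient_adapted2 X0_rv Z_rv Z_indep Z_X0_indep theta_lip
  Xb0_sub Zb_sub XbE Xb0_int Zb_int).
Qed.

Let Z_adapted2 k : (k < n)%N ->
  forall j, adapted2 P (H k) (fun w => Z k.+1 w j 0).
Proof.
exact: (noise_adapted2 (fun k _ => @subset_refl _ (H k)) Z_int).
Qed.

Let Zb_adapted2 k : (k < n)%N ->
  forall j, adapted2 P (H k) (fun w => Zb k.+1 w j 0).
Proof. exact: (noise_adapted2 Zb_sub Zb_int). Qed.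

Let D k w := X k w - Xb k w.
Let B k w := theta k (X k w) - theta k (Xb k w).
Let x k w := Z k.+1 w - Zb k.+1 w.

Let D_adapted2 k j : (j <= k)%N -> (k <= n)%N ->
  forall i, adapted2 P (F k) (fun w => D j w i 0).
Proof.
move=> jk kn i.
have -> : (fun w => D j w i 0) = (fun w => X j w i 0 - Xb j w i 0).
  by apply/funext => w; rewrite !mxE.
by apply: adapted2B; [exact: X_adapted2|exact: Xb_adapted2].
Qed.

Let B_adapted2 k : (k < n)%N ->
  forall i j, adapted2 P (F k) (fun w => B k w i j).
Proof.
move=> kn i j.
have -> : (fun w => B k w i j) =
    (fun w => theta k (X k w) i j - theta k (Xb k w) i j).
  by apply/funext => w; rewrite !mxE.
by apply: adapted2B; [exact: A_adapted2|exact: Ab_adapted2].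
Qed.

Let x_adapted2 k : (k < n)%N -> forall j, adapted2 P (H k) (fun w => x k w j 0).
Proof.
move=> kn j.
have -> : (fun w => x k w j 0) = (fun w => Z k.+1 w j 0 - Zb k.+1 w j 0).
  by apply/funext => w; rewrite !mxE.
by apply: adapted2B; [exact: Z_adapted2|exact: Zb_adapted2].
Qed.

Let Zb_mean0 k : (k < n)%N -> forall j, mean P (fun w => Zb k.+1 w j 0) = 0.
Proof. by move=> kn j; apply: mean_expectation; exact: Zb_centered. Qed.

Let Z_mean0 k : (k < n)%N -> forall j, mean P (fun w => Z k.+1 w j 0) = 0.
Proof.
move=> kn j; apply: mean_expectation; case: Z_noise => _ _ _ Z0 _.
exact: (Z0 (Ordinal kn)).
Qed.

Let Z_cov k : (k < n)%N -> forall i j,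
  mean P (fun w => Z k.+1 w i 0 * Z k.+1 w j 0) = (i == j)%:R.
Proof.
move=> kn i j; case: Z_noise => _ _ _ Z0 ZI.
exact: mean_covariance (Z0 (Ordinal kn) i) (Z0 (Ordinal kn) j)
  (ZI (Ordinal kn) i j).
Qed.

Let x_mean0 k : (k < n)%N -> forall j, mean P (fun w => x k w j 0) = 0.
Proof.
move=> kn j; transitivity (mean P (fun w => Z k.+1 w j 0 + -1 * Zb k.+1 w j 0)).
  by apply: eq_mean => w; rewrite /x !mxE mulN1r.
have IZ := integrable21 (Z_int kn j); have IZb := integrable21 (Zb_int kn j).
rewrite meanD ?meanZ//; last exact: integrable1Z.
by rewrite Z_mean0// Zb_mean0// mulr0 addr0.
Qed.

Let x_orth k : (k < n)%N -> forall i j,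
  mean P (fun w => x k w i 0 * Zb k.+1 w j 0) = 0.
Proof.
move=> kn i j; under eq_mean do rewrite /x !mxE.
by apply: mean_expectation; exact: Zb_orth.
Qed.

(* [Z = (Z - Zb) + Zb] is an orthogonal decomposition in each coordinate. *)
Let Zb_mean_sqr k : (k < n)%N ->
  mean P (fun w => euclid (Zb k.+1 w) ^+ 2) <= q%:R.
Proof.
move=> kn; rewrite mean_sqr_euclid; last exact: Zb_int.
have -> : q%:R = \sum_(j < q) 1 :> R by rewrite sumr_const card_ord.
apply: ler_sum => j _.
have -> : 1 = mean P (fun w => Z k.+1 w j 0 * Z k.+1 w j 0).
  by rewrite Z_cov ?eqxx.
have [_ Ix] := x_adapted2 kn j; have IZb := Zb_int kn j.
have -> : mean P (fun w => Z k.+1 w j 0 * Z k.+1 w j 0) =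
    mean P (fun w => x k w j 0 ^+ 2 + Zb k.+1 w j 0 ^+ 2
                     + 2 * (x k w j 0 * Zb k.+1 w j 0)).
  by apply: eq_mean => w; rewrite /x !mxE; ring.
have IxZb := integrable2M Ix IZb; case: Ix IZb => [_ Ix] [_ IZb].
rewrite meanD//; [|exact: integrable1D|exact: integrable1Z].
rewrite meanD// meanZ// x_orth// mulr0 addr0 lerDr.
by apply: mean_ge0 => w; exact: sqr_ge0.
Qed.

Let D_step k : (k < n)%N -> forall w,
  D k.+1 w = D k w + theta k (X k w) *m x k w + B k w *m Zb k.+1 w.
Proof.
move=> kn w; rewrite /D XE// XbE// /x /B mulmxBr mulmxBl.
by apply/matrixP => i j; rewrite !mxE; ring.
Qed.

Let a k := mean P (fun w => euclid (D k w) ^+ 2).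
Let v k := 1 + mean P (fun w => euclid (X k w) ^+ 2).
Let z k := mean P (fun w => euclid (Z k w - Zb k w) ^+ 2).

Let X_int k : (k <= n)%N -> forall i, integrable2 P (fun w => X k w i 0).
Proof. by move=> kn i; case: (X_adapted2 (leqnn k) kn i). Qed.

Let D_int k : (k <= n)%N -> forall i, integrable2 P (fun w => D k w i 0).
Proof. by move=> kn i; case: (D_adapted2 (leqnn k) kn i). Qed.

Let vE k : (k <= n)%N -> v k = mean P (fun w => 1 + euclid (X k w) ^+ 2).
Proof.
move=> kn; rewrite meanD ?mean_cst//; first exact: integrable1_cst.
exact: integrable1_sqr_euclid (X_int kn).
Qed.

Let error_step k : (k < n)%N ->
  a k.+1 <= a k * (1 + q%:R * lip (theta k) ^+ 2)
            + c_op (theta k) * v k * z k.+1.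
Proof.
move=> kn; have kn' := ltnW kn; have tl := theta_lip kn.
have -> : a k.+1 = mean P (fun w => euclid (D k w + theta k (X k w) *m x k w
    + B k w *m Zb k.+1 w) ^+ 2).
  by apply: eq_mean => w; rewrite D_step.
rewrite (mean_sqr_martingale_step (Fm (k := k)) (Hm kn) (FH_indep kn)
  (D_adapted2 (leqnn k) kn') (A_adapted2 kn) (B_adapted2 kn) (x_adapted2 kn)
  (Zb_adapted2 kn) (x_mean0 kn) (Zb_mean0 kn) (x_orth kn)).
have F_euclid (Y : T -> 'cV[R]_d) :
    (forall i, adapted2 P (F k) (fun w => Y w i 0)) ->
    adapted (F k) (fun w => euclid (Y w) ^+ 2).
  move=> FY; apply: measurable_funX; apply: measurable_euclid => i.
  by case: (FY i).
have hA := mean_sqr_mulmx_le (Fm (k := k)) (Hm kn) (FH_indep kn)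
  (g := fun w => 1 + euclid (X k w) ^+ 2) (c := c_op (theta k))
  (A_adapted2 kn) (x_adapted2 kn).
have {}hA : mean P (fun w => euclid (theta k (X k w) *m x k w) ^+ 2) <=
    c_op (theta k) * v k * z k.+1.
  rewrite vE//; apply: hA.
  - apply: measurable_funD => //; exact: F_euclid (X_adapted2 (leqnn k) kn').
  - apply: integrable1D; first exact: integrable1_cst.
    exact: integrable1_sqr_euclid (X_int kn').
  - by move=> w; exact: sqr_opnorm_le_c_op.
have hB := mean_sqr_mulmx_le (Fm (k := k)) (Hm kn) (FH_indep kn)
  (g := fun w => euclid (D k w) ^+ 2) (c := lip (theta k) ^+ 2)
  (B_adapted2 kn) (Zb_adapted2 kn).
have {}hB : mean P (fun w => euclid (B k w *m Zb k.+1 w) ^+ 2) <=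
    lip (theta k) ^+ 2 * a k * q%:R.
  apply: le_trans (_ : lip (theta k) ^+ 2 * a k *
    mean P (fun w => euclid (Zb k.+1 w) ^+ 2) <= _).
    apply: hB.
    - exact: F_euclid (D_adapted2 (leqnn k) kn').
    - exact: integrable1_sqr_euclid (D_int kn').
    - by move=> w; exact: sqr_opnorm_le_lip.
  rewrite ler_wpM2l ?Zb_mean_sqr// mulr_ge0 ?sqr_ge0// mean_ge0// => w.
  exact: sqr_ge0.
rewrite -/(a k); move: hA hB; lra.
Qed.

(* [X] alone is the case of a martingale step with a zero second noise. *)
Let growth_step k : (k < n)%N -> v k.+1 <= v k * (1 + c_frob (theta k)).
Proof.
move=> kn; have kn' := ltnW kn; have tl := theta_lip kn.
have Z0Z i j : mean P (fun w => Z k.+1 w i 0 * (0 : 'cV[R]_q) j 0) = 0.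
  by under eq_mean do rewrite mxE mulr0; rewrite mean_cst.
have H0 (j : 'I_q) : adapted2 P (H k) (fun w => (0 : 'cV[R]_q) j 0).
  split; first exact: measurable_cst.
  by apply: (@integrable2_bounded _ _ _ _ _ 0) => // w; rewrite mxE expr0n.
have mean0 (j : 'I_q) : mean P (fun w => (0 : 'cV[R]_q) j 0) = 0.
  by rewrite mean_cst mxE.
have XS : mean P (fun w => euclid (X k.+1 w) ^+ 2) =
    mean P (fun w => euclid (X k w) ^+ 2)
    + mean P (fun w => frob (theta k (X k w)) ^+ 2).
  transitivity (mean P (fun w => euclid (X k w + theta k (X k w) *m Z k.+1 w
      + theta k (X k w) *m 0) ^+ 2)).
    by apply: eq_mean => w; rewrite mulmx0 addr0 XE.
  rewrite (mean_sqr_martingale_step (Fm (k := k)) (Hm kn) (FH_indep kn)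
    (X_adapted2 (leqnn k) kn') (A_adapted2 kn) (A_adapted2 kn) (Z_adapted2 kn)
    H0 (Z_mean0 kn) mean0 Z0Z).
  rewrite (mean_sqr_mulmx_white (Fm (k := k)) (Hm kn) (FH_indep kn)
    (A_adapted2 kn) (Z_adapted2 kn) (Z_cov kn)).
  under [X in _ + X = _]eq_mean do rewrite mulmx0 euclid0 expr0n.
  by rewrite mean_cst addr0.
have frob_le : mean P (fun w => frob (theta k (X k w)) ^+ 2) <=
    c_frob (theta k) * v k.
  rewrite vE// -meanZ; last first.
    by apply: integrable1D; [exact: integrable1_cst|
      exact: integrable1_sqr_euclid (X_int kn')].
  apply: mean_le => [||w]; last exact: sqr_frob_le_c_frob.
    under eq_fun do rewrite sqr_frob.
    apply: integrable1_sum => i; apply: integrable1_sum => j.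
    by case: (A_adapted2 kn i j) => _ [].
  apply: integrable1Z; apply: integrable1D; first exact: integrable1_cst.
  exact: integrable1_sqr_euclid (X_int kn').
by move: frob_le; rewrite /v XS; lra.
Qed.

Let mean_sqr_error_le k : (k <= n)%N ->
  a k <= a 0%N * \prod_(1 <= i < k.+1) (1 + q%:R * lip (theta i.-1) ^+ 2)
         + v 0%N * \prod_(1 <= i < k.+1) (1 + C_max (theta i.-1))
           * \sum_(1 <= l < k.+1) c_op (theta l.-1) * z l.
Proof.
apply: (@discrete_gronwall _ n a v z (fun k => q%:R * lip (theta k) ^+ 2)
  (fun k => c_frob (theta k)) (fun k => c_op (theta k))) => //.
- by move=> j _; rewrite mulr_ge0 ?ler0n ?sqr_ge0.
- by move=> j jn; exact: c_op_ge0 (theta_lip jn).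
- by move=> j; apply: mean_ge0 => w; exact: sqr_ge0.
- by move=> j _; rewrite addr_ge0// mean_ge0// => w; exact: sqr_ge0.
Qed.

Let M w := \big[Num.max/0]_(k < n.+1) euclid (D k w).

Let euclid_D_adapted2 k j : (j <= k)%N -> (k <= n)%N ->
  adapted2 P (F k) (fun w => euclid (D j w)).
Proof.
move=> jk kn; split.
  by apply: measurable_euclid => i; case: (D_adapted2 jk kn i).
by apply: integrable2_euclid => i; case: (D_adapted2 jk kn i).
Qed.

Let max_error_integrable2 : integrable2 P M.
Proof.
by have [] := running_max_adapted2 Fm euclid_D_adapted2 (leqnn n).
Qed.

Let mean_sqr_max_error_le : mean P (fun w => M w ^+ 2) <= 4 * a n.
Proof.
apply: (doob_mean_square Fm euclid_D_adapted2) => [k w|k f kn Ff f0].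
  exact: euclid_ge0.
under [leRHS]eq_mean do rewrite D_step//.
exact: (mean_euclid_submartingale (Fm (k := k)) (Hm kn) (FH_indep kn) Ff f0
  (D_adapted2 (leqnn k) (ltnW kn)) (A_adapted2 kn) (B_adapted2 kn)
  (x_adapted2 kn) (Zb_adapted2 kn) (x_mean0 kn) (Zb_mean0 kn)).
Qed.

Let L2norm_error k : (k <= n)%N ->
  (L2norm P (fun w => X k w - Xb k w)%R ^+ 2 = (a k)%:E)%E.
Proof. by move=> kn; rewrite L2norm_sqr//; exact: D_int. Qed.

Let L2norm_noise k : (k < n)%N ->
  (L2norm P (fun w => Z k.+1 w - Zb k.+1 w)%R ^+ 2 = (z k.+1)%:E)%E.
Proof. by move=> kn; rewrite L2norm_sqr// => j; case: (x_adapted2 kn j). Qed.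

Let L2norm_X0 : (1 + L2norm P (X 0%N) ^+ 2 = (v 0%N)%:E)%E.
Proof. by rewrite L2norm_sqr//; exact: X0_int. Qed.

Lemma L2norm_error_le k : (k <= n)%N ->
  (L2norm P (fun w => X k w - Xb k w)%R ^+ 2 <=
     L2norm P (fun w => X 0%N w - Xb 0%N w)%R ^+ 2
       * (\prod_(1 <= i < k.+1) (1 + q%:R * lip (theta i.-1) ^+ 2)%R)%R%:E
     + (1 + L2norm P (X 0%N) ^+ 2)
       * (\prod_(1 <= i < k.+1) (1 + C_max (theta i.-1))%R)%R%:E
       * \sum_(1 <= l < k.+1) ((c_op (theta l.-1))%:E
           * L2norm P (fun w => Z l w - Zb l w)%R ^+ 2))%E.
Proof.
move=> kn; rewrite (L2norm_error kn) (L2norm_error (leq0n n)) L2norm_X0.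
rewrite (eq_big_nat _ _ (F2 := fun l => (c_op (theta l.-1) * z l)%:E)).
  by rewrite sumEFin -!EFinM -EFinD lee_fin mean_sqr_error_le.
case=> [//|l] /andP[_ lk]; have ln := leq_trans (lk : (l < k)%N) kn.
by rewrite (L2norm_noise ln) EFinM.
Qed.

Lemma L2norm_max_error_le :
  ('N[P]_2%:E[(fun w =>
      (\big[Num.max/0%R]_(k < n.+1) euclid (X k w - Xb k w)%R)%:E)] ^+ 2
    <= 4%:E * L2norm P (fun w => X n w - Xb n w)%R ^+ 2)%E.
Proof.
rewrite (L2norm_error (leqnn n)) (Lnorm2_sqr max_error_integrable2).
by rewrite -EFinM lee_fin mean_sqr_max_error_le.
Qed.

End quantization.

Theorem proposition2p1 (R : realType) (disp : measure_display)
  (T : measurableType disp) (P : probability T R)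
  (d q n : nat) (d_gt0 : (0 < d)%N) (q_gt0 : (0 < q)%N) (n_gt0 : (0 < n)%N)
  (theta : nat -> 'cV[R]_d -> 'M[R]_(d, q))
  (theta_lip : forall k, (k < n)%N -> lipschitz_op (theta k))
  (X Xb : nat -> T -> 'cV[R]_d) (Z Zb : nat -> T -> 'cV[R]_q)
  (X0_rv : random_vector (X 0%N)) (X0_L2 : (L2norm P (X 0%N) < +oo)%E)
  (Z_noise : white_noise P (fun k : 'I_n => Z k.+1))
  (Z_X0_indep : independent2 P (sigma_of (X 0%N))
                  (sigma_of_family (fun k : 'I_n => Z k.+1)))
  (phi : nat -> 'cV[R]_q -> 'cV[R]_q)
  (phi_borel : forall k, (1 <= k <= n)%N -> borel_fun (phi k))
  (phi_bounded : forall k, (1 <= k <= n)%N -> bounded_vfun (phi k))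
  (ZbE : forall k, (1 <= k <= n)%N -> forall w, Zb k w = phi k (Z k w))
  (Zb_centered : forall k, (1 <= k <= n)%N ->
    forall i, ('E_P[(fun w => Zb k w i 0)%R] = 0)%E)
  (Zb_orth : forall k, (1 <= k <= n)%N -> forall i j,
    ('E_P[(fun w => (Z k w i 0 - Zb k w i 0) * Zb k w j 0)%R] = 0)%E)
  (g0 : 'cV[R]_d -> 'cV[R]_d)
  (g0_borel : borel_fun g0) (g0_bounded : bounded_vfun g0)
  (Xb0E : forall w, Xb 0%N w = g0 (X 0%N w))
  (XE : forall k, (k < n)%N -> forall w,
    X k.+1 w = X k w + theta k (X k w) *m Z k.+1 w)
  (XbE : forall k, (k < n)%N -> forall w,
    Xb k.+1 w = Xb k w + theta k (Xb k w) *m Zb k.+1 w) :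
  (forall k, (k <= n)%N ->
    (L2norm P (fun w => X k w - Xb k w)%R ^+ 2 <=
       L2norm P (fun w => X 0%N w - Xb 0%N w)%R ^+ 2
         * (\prod_(1 <= i < k.+1) (1 + q%:R * lip (theta i.-1) ^+ 2)%R)%R%:E
       + (1 + L2norm P (X 0%N) ^+ 2)
         * (\prod_(1 <= i < k.+1) (1 + C_max (theta i.-1))%R)%R%:E
         * \sum_(1 <= l < k.+1) ((c_op (theta l.-1))%:E
             * L2norm P (fun w => Z l w - Zb l w)%R ^+ 2))%E) /\
  ('N[P]_2%:E[(fun w =>
      (\big[Num.max/0%R]_(k < n.+1) euclid (X k w - Xb k w)%R)%:E)] ^+ 2
    <= 4%:E * L2norm P (fun w => X n w - Xb n w)%R ^+ 2)%E.
Proof.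
split=> [k kn|].
  exact: (L2norm_error_le theta_lip X0_rv X0_L2 Z_noise Z_X0_indep phi_borel
    phi_bounded ZbE Zb_centered Zb_orth g0_borel g0_bounded Xb0E XE XbE kn).
exact: (L2norm_max_error_le theta_lip X0_rv X0_L2 Z_noise Z_X0_indep phi_borel
  phi_bounded ZbE Zb_centered g0_borel g0_bounded Xb0E XE XbE).
Qed.
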